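(* Let $G$ be a countable amenable group. Then the set of actions of $G$ on $L_1[0,1]$ by lattice (positive) linear isometries that admit an equivalent $G$-invariant strictly convex norm is dense in $\mathrm{Act}^+_G(L_1[0,1])$.
   Context: $L_1[0,1]$ is the real Banach lattice of integrable functions on $[0,1]$ with Lebesgue measure. $\mathrm{LIso}(L_1[0,1])$ is the group of surjective positive linear isometries of $L_1[0,1]$ with the strong operator topology. $\mathrm{Act}^+_G(L_1[0,1])$ is the set of group homomorphisms $G\to\mathrm{LIso}(L_1[0,1])$ viewed as a closed subset of $\mathrm{LIso}(L_1[0,1])^G$ with the product topology. A discrete countable group is amenable if every action of it on a compact Hausdorff space admits an invariant Borel probability measure. A norm is $G$-invariant if each $g\in G$ acts isometrically for it; strictly convex if for $f\neq h$ of equal norm, $\|\frac{f+h}{2}\|<\|f\|$. *)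

(* Defs.v *)
From HB Require Import structures.
From mathcomp Require Import all_boot all_order all_algebra.
From mathcomp Require Import all_classical all_reals all_analysis.
Set Implicit Arguments. Unset Strict Implicit. Unset Printing Implicit Defensive.
Import Order.TTheory GRing.Theory Num.Theory.
Import numFieldNormedType.Exports.
Local Open Scope classical_set_scope.
Local Open Scope ring_scope.

Definition countable_group (G : groupType) : Prop :=
  exists f : G -> nat, injective f.

(* Amenability, as in the paper: every action of G (by homeomorphisms) on a
   (nonempty) compact Hausdorff space admits an invariant Borel probability
   measure.  Borel = sigma-algebra generated by the open sets. *)
Definition amenable (R : realType) (G : groupType) : Prop :=
  forall (X : ptopologicalType) (alpha : G -> X -> X),
    compact [set: X] -> hausdorff_space X ->
    (forall g, continuous (alpha g)) ->
    (forall x, alpha monoid.one x = x) ->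
    (forall g h x, alpha (monoid.mul g h) x = alpha g (alpha h x)) ->
    exists P : probability (g_sigma_algebraType (@open X)) R,
      forall g (A : set (g_sigma_algebraType (@open X))),
        measurable A -> P (alpha g @^-1` A) = P A.

(* L_1[0,1] with Lebesgue measure, represented by functions R -> R
   (representatives), with equality almost everywhere on [0,1].        *)
Section L1.
Variable R : realType.
Local Notation leb := (@lebesgue_measure R).
Local Notation I01 := (`[(0:R), (1:R)]%classic : set R).

Definition L1 (f : R -> R) : Prop := leb.-integrable I01 (EFin \o f).

Definition norm1 (f : R -> R) : R :=
  fine (\int[leb]_(x in I01) (`|f x|)%:E)%E.

Definition aeq (f g : R -> R) : Prop :=
  {ae leb, forall x, I01 x -> f x = g x}.

Definition ae_nonneg (f : R -> R) : Prop :=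
  {ae leb, forall x, I01 x -> 0 <= f x}.

(* an operator, given by its action on representatives *)
Definition Op := (R -> R) -> (R -> R).

Definition is_LIso (T : Op) : Prop :=
  [/\ (forall f, L1 f -> L1 (T f)),
      (forall f g, L1 f -> L1 g -> aeq f g -> aeq (T f) (T g)),
      (forall (a b : R) f g, L1 f -> L1 g ->
          aeq (T (fun x => a * f x + b * g x))
              (fun x => a * T f x + b * T g x)),
      (forall f, L1 f -> ae_nonneg f -> ae_nonneg (T f))
    & (forall f, L1 f -> norm1 (T f) = norm1 f)] /\
    (forall h, L1 h -> exists f, L1 f /\ aeq (T f) h).

Definition is_action (G : groupType) (rho : G -> Op) : Prop :=
  [/\ (forall g, is_LIso (rho g)),
      (forall f, L1 f -> aeq (rho monoid.one f) f)
    & (forall g h f, L1 f ->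
          aeq (rho (monoid.mul g h) f) (rho g (rho h f)))].

Definition equiv_norm (N : (R -> R) -> R) : Prop :=
  [/\ (forall f g, L1 f -> L1 g -> aeq f g -> N f = N g),
      (forall f g, L1 f -> L1 g -> N (fun x => f x + g x) <= N f + N g),
      (forall (a : R) f, L1 f -> N (fun x => a * f x) = `|a| * N f)
    & exists c C : R, [/\ 0 < c, 0 < C &
         forall f, L1 f -> c * norm1 f <= N f /\ N f <= C * norm1 f]].

Definition invariant_norm (G : groupType) (rho : G -> Op)
    (N : (R -> R) -> R) : Prop :=
  forall g f, L1 f -> N (rho g f) = N f.

Definition strictly_convex (N : (R -> R) -> R) : Prop :=
  forall f h, L1 f -> L1 h -> ~ aeq f h -> N f = N h ->
    N (fun x => (f x + h x) / 2) < N f.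

Definition admits_inv_sc_norm (G : groupType) (rho : G -> Op) : Prop :=
  exists N : (R -> R) -> R,
    [/\ equiv_norm N, invariant_norm rho N & strictly_convex N].

End L1.

(* Main.v *)
Require Import Defs.
From HB Require Import structures.
From mathcomp Require Import all_boot all_order all_algebra.
From mathcomp Require Import all_classical all_reals all_analysis.
From mathcomp Require Import measurable_realfun ring lra.
Import Order.TTheory GRing.Theory Num.Theory.
Import numFieldNormedType.Exports.
Local Open Scope classical_set_scope.
Local Open Scope ring_scope.

Set Implicit Arguments.
Unset Strict Implicit.
Unset Printing Implicit Defensive.

(** Let [l1(G; L1)] carry the action [(g F)(h) = rho_g (F (g^-1 h))]. It is
    conjugate to the left translation [F |-> F (g^-1 .)] by
    [F |-> (rho_(h^-1) (F h))_h], and translation preserves the norm whose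
    square is [|F|_1^2 + sum_(h, q) l_q (F h)^2] for any square-summable family
    of functionals [l_q] separating the points of [L1]; such a norm is strictly
    convex by the parallelogram identity.

    If [p > 0] is a probability on [G], the map [f |-> p (x) f] into
    [l1(G; L1)] is almost equivariant when [p] is almost invariant, and it is
    approximated in the strong topology by surjective lattice isometries [D]:
    cut [0,1] into small cells, cut each cell in the proportions [p h], and
    stretch the [h]-th pieces back onto the cells. Conjugating the action on
    [l1(G; L1)] back by [D] gives an action close to [rho] with an invariant
    strictly convex norm.

    Almost invariant probabilities exist by amenability. The means on bounded
    functions form a compact [G]-space, and averaging them against an invariant
    measure gives an invariant mean. If no probability were almost invariant,
    Hahn-Banach would provide bounded functions [u_i] such that
    [k |-> sum_i (u_i (s_i k) - u_i k)] is bounded below by a positive constant,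
    although its invariant mean is 0. *)

(** * Hahn-Banach *)

Section hahn_banach.
Variables (R : realType) (V : lmodType R).
Implicit Types (p q : V -> R) (x y c : V).

Definition sublinear p :=
  (forall x y, p (x + y) <= p x + p y) /\
  (forall (a : R) x, 0 <= a -> p (a *: x) = a * p x).

Lemma sublinear0 p : sublinear p -> p 0 = 0.
Proof. by move=> [_ pZ]; rewrite -(scale0r 0) pZ// mul0r. Qed.

Lemma sublinear_oppr_ge p x : sublinear p -> - p (- x) <= p x.
Proof.
by move=> sp; rewrite -subr_ge0 opprK -(sublinear0 sp) -(subrr x) sp.1.
Qed.

Lemma sublinear_inf (I : Type) (A : set I) (F : I -> V -> R) :
  A !=set0 -> (forall x, has_lbound [set F i x | i in A]) ->
  (forall i j x y, A i -> A j ->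
    exists2 k, A k & F k (x + y) <= F i x + F j y) ->
  (forall i (a : R) x, A i -> 0 < a ->
    exists2 k, A k & F k (a *: x) <= a * F i x) ->
  sublinear (fun x => inf [set F i x | i in A]).
Proof.
move=> [i0 Ai0] lbF addF scaleF.
pose q x := inf [set F i x | i in A]; rewrite -/q.
have q_le i x : A i -> q x <= F i x by move=> Ai; apply: ge_inf => //; exists i.
have le_q x r : (forall i, A i -> r <= F i x) -> r <= q x.
  by move=> rF; apply: lb_le_inf; [exists (F i0 x), i0|move=> _ [i /rF ? <-]].
have qZ_le (a : R) x : 0 < a -> q (a *: x) <= a * q x.
  move=> a0; rewrite -ler_pdivrMl//; apply: (le_q x) => i Ai.
  have [k Ak] := scaleF i a x Ai a0.
  by rewrite ler_pdivrMl//; apply: le_trans; exact: q_le.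
have qZ (a : R) x : 0 < a -> q (a *: x) = a * q x.
  move=> a0; apply/eqP; rewrite eq_le qZ_le//= -ler_pdivlMl//.
  by rewrite -[in leLHS](scalerK (lt0r_neq0 a0) x) qZ_le// invr_gt0.
split=> [x y|a x].
  rewrite -lerBlDr; apply: (le_q x) => i Ai.
  rewrite lerBlDr [leRHS]addrC -lerBlDr; apply: (le_q y) => j Aj.
  have [k Ak] := addF i j x y Ai Aj.
  by rewrite lerBlDr [leRHS]addrC; apply: le_trans; exact: q_le.
rewrite le_eqVlt => /predU1P[<-|]; last exact: qZ.
have := qZ 2 0 (ltr0Sn _ 1); rewrite scaler0 scale0r mul0r; lra.
Qed.

Lemma convex_set_cone (C : set V) c c' (t t' : R) :
  convex_set C -> C c -> C c' -> 0 <= t -> 0 <= t' ->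
  exists2 d, C d & (t + t') *: d = t *: c + t' *: c'.
Proof.
move=> convC Cc Cc' t0 t'0.
have [s0|s0] := eqVneq (t + t') 0.
  have [-> ->] : t = 0 /\ t' = 0 by split; lra.
  by exists c => //; rewrite addr0 !scale0r addr0.
have sgt0 : 0 < t + t' by rewrite lt0r s0 addr_ge0.
have a0 : 0 <= t / (t + t') by rewrite divr_ge0// ltW.
have a1 : t / (t + t') <= 1 by rewrite ler_pdivrMr// mul1r lerDl.
exists ((t / (t + t')) *: c + (1 - t / (t + t')) *: c').
  exact: set_mem (convC c c' (Itv01 a0 a1) (mem_set Cc) (mem_set Cc')).
rewrite scalerDr !scalerA mulrBr mulr1 mulrCA divff// mulr1.
by rewrite addrAC subrr add0r.
Qed.

(* The witness is [x |-> inf_(t >= 0, c in C) p (x + t c) - t e]. *)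
Lemma sublinear_minorant p (C : set V) (e : R) :
  sublinear p -> C !=set0 -> convex_set C -> (forall c, C c -> e <= p c) ->
  exists q, [/\ sublinear q, (forall x, q x <= p x) &
    forall c, C c -> q (- c) <= - e].
Proof.
move=> sp [c0 Cc0] convC Ce.
pose A := [set i : R * V | 0 <= i.1 /\ C i.2].
pose F (i : R * V) x := p (x + i.1 *: i.2) - i.1 * e.
have lbF x i : A i -> - p (- x) <= F i x.
  move=> [t0 Ci]; have := sp.1 (x + i.1 *: i.2) (- x).
  rewrite addrAC subrr add0r sp.2// /F.
  have := ler_wpM2l t0 (Ce _ Ci); lra.
have lbA x : has_lbound [set F i x | i in A].
  by exists (- p (- x)) => _ [i Ai <-]; exact: lbF.
have inf_le i x : A i -> inf [set F i x | i in A] <= F i x.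
  by move=> Ai; apply: ge_inf => //; exists i.
exists (fun x => inf [set F i x | i in A]); split.
- apply: sublinear_inf => //; first by exists (0, c0).
    move=> [t c] [t' c'] x y [/= t0 Cc] [/= t'0 Cc'].
    have [d Cd dE] := convex_set_cone convC Cc Cc' t0 t'0.
    exists (t + t', d); first by split=> //=; rewrite addr_ge0.
    rewrite /F/= dE addrACA; have := sp.1 (x + t *: c) (y + t' *: c'); lra.
  move=> [t c] a x [/= t0 Cc] a0; exists (a * t, c).
    by split=> //=; rewrite mulr_ge0// ltW.
  by rewrite /F/= -scalerA -scalerDr (sp.2 _ _ (ltW a0)) mulrBr mulrA lexx.
- move=> x; have := inf_le (0, c0) x (conj (lexx 0) Cc0).
  by rewrite /F/= scale0r addr0 mul0r subr0.
- move=> c Cc; have := inf_le (1, c) (- c) (conj ler01 Cc).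
  by rewrite /F/= scale1r addNr mul1r (sublinear0 sp) sub0r.
Qed.

Definition minimal_sublinear p :=
  sublinear p /\
  forall p', sublinear p' -> (forall x, p' x <= p x) -> p' = p.

Lemma exists_minimal_sublinear q : sublinear q ->
  exists2 p, minimal_sublinear p & forall x, p x <= q x.
Proof.
move=> sq; pose T := {p : V -> R | sublinear p /\ forall x, p x <= q x}.
pose below (p p' : T) := `[< forall x, sval p' x <= sval p x >].
have [p|p1 p2 p3|p1 p2|A totA|p minp] := @Zorn T below.
- exact/asboolP.
- move=> /asboolP le21 /asboolP le32; apply/asboolP => x.
  exact: le_trans (le21 x).
- move=> /asboolP le21 /asboolP le12; apply: eq_sig_hprop => /=.
    by move=> ?; exact: Prop_irrelevance.
  by apply/funext => x; apply/eqP; rewrite eq_le le12 le21.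
- have [A0|/set0P/negP] := pselect (A !=set0); last first.
    rewrite negbK => /eqP ->.
    by exists (exist _ q (conj sq (fun x => lexx _))).
  have lbA x : has_lbound [set sval p x | p in A].
    exists (- q (- x)) => _ [p _ <-].
    apply: le_trans (sublinear_oppr_ge _ (svalP p).1).
    by rewrite lerN2 (svalP p).2.
  pose infA x := inf [set sval p x | p in A].
  have inf_le x (p : T) : A p -> infA x <= sval p x.
    by move=> Ap; apply: ge_inf => //; exists p.
  have s_inf : sublinear infA.
    apply: sublinear_inf => // [p p' x y Ap Ap'|p a x Ap a0].
      have [/asboolP p'p|/asboolP pp'] := totA p p' Ap Ap'.
        exists p' => //; apply: le_trans ((svalP p').1.1 _ _) _.
        by rewrite lerD2r.
      exists p => //; apply: le_trans ((svalP p).1.1 _ _) _.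
      by rewrite lerD2l.
    by exists p => //; rewrite ((svalP p).1.2 _ _ (ltW a0)).
  have inf_le_q x : infA x <= q x.
    have [p0 Ap0] := A0; apply: le_trans (inf_le x p0 Ap0) _.
    exact: (svalP p0).2.
  exists (exist _ infA (conj s_inf inf_le_q)) => p Ap.
  by apply/asboolP => x; exact: inf_le.
have [sp pq] := svalP p; exists (sval p) => //; split=> // p' sp' p'p.
have p'q x : p' x <= q x by exact: le_trans (pq x).
by have /(congr1 sval)/= -> := minp (exist _ p' (conj sp' p'q)) (asboolT p'p).
Qed.

(* Otherwise [sublinear_minorant] with [C = {x}] and [e = p x] would lower [p]. *)
Lemma minimal_sublinearN p x : minimal_sublinear p -> p (- x) = - p x.
Proof.
move=> [sp minp]; apply/eqP; rewrite eq_le.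
have := sublinear_oppr_ge (- x) sp; rewrite opprK => ->; rewrite andbT.
have [|c c' a|c ->|p' [sp' le_p' p'x]] :=
  @sublinear_minorant p [set x] (p x) sp => //.
- by exists x.
- by rewrite !inE => -> ->; rewrite convmm.
by apply: le_trans (p'x x erefl); rewrite (minp p' sp' le_p').
Qed.

Theorem hahn_banach q : sublinear q ->
  exists l : {scalar V}, forall x, l x <= q x.
Proof.
move=> /exists_minimal_sublinear[p minp pq]; have [sp _] := minp.
have pN x : p (- x) = - p x by exact: minimal_sublinearN.
have pD x y : p (x + y) = p x + p y.
  apply/eqP; rewrite eq_le sp.1/=.
  by have := sp.1 (- x) (- y); rewrite -opprD !pN; lra.
have pZ (a : R) x : p (a *: x) = a * p x.
  have [a0|a0] := leP 0 a; first exact: sp.2.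
  rewrite -[a in LHS]opprK scaleNr pN sp.2; last by rewrite oppr_ge0 ltW.
  by rewrite mulNr opprK.
have p_linear : scalar p by move=> a x y; rewrite pD pZ.
pose pL := GRing.isLinear.Build R V R *%R p p_linear.
by exists (HB.pack p pL : {scalar V}).
Qed.

Lemma hahn_banach_separation p (C : set V) (e : R) :
  sublinear p -> C !=set0 -> convex_set C -> (forall c, C c -> e <= p c) ->
  exists2 l : {scalar V}, (forall x, l x <= p x) &
    forall c, C c -> e <= l c.
Proof.
move=> sp C0 convC Ce; have [q [sq qp qC]] := sublinear_minorant sp C0 convC Ce.
have [l lq] := hahn_banach sq; exists l => [x|c Cc].
  exact: le_trans (qp x).
by have := le_trans (lq (- c)) (qC _ Cc); rewrite linearN lerN2.
Qed.

End hahn_banach.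

Section separation_of_families.
Variables (R : realType) (V : lmodType R) (I : finType).

Definition single (i : I) (x : V) : I -> V := fun j => if j == i then x else 0.

Fact single_linear i : linear (single i).
Proof.
move=> a x y; apply/funext => j; rewrite /single !fctE.
by case: ifP => // _; rewrite scaler0 addr0.
Qed.

HB.instance Definition _ i := GRing.isLinear.Build R V (I -> V) *:%R (single i)
  (single_linear i).

Lemma sum_single (x : I -> V) : x = \sum_i single i (x i).
Proof.
apply/funext => j; rewrite fct_sumE (bigD1 j)//= /single eqxx big1 ?addr0//.
by move=> i /negPf; rewrite eq_sym => ->.
Qed.

Lemma hahn_banach_separation_family (p : V -> R) (C : set (I -> V)) (e : R) :
  sublinear p -> C !=set0 -> convex_set C ->
  (forall c, C c -> e <= \sum_i p (c i)) ->
  exists2 l : I -> {scalar V}, (forall i x, l i x <= p x) &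
    forall c, C c -> e <= \sum_i l i (c i).
Proof.
move=> sp C0 convC Ce.
have sum_p : sublinear (fun x : I -> V => \sum_i p (x i)).
  split=> [x y|a x a0].
    by rewrite -big_split/= ler_sum// => i _; exact: sp.1.
  by rewrite mulr_sumr; apply: eq_bigr => i _; exact: sp.2.
have [l lp lC] := hahn_banach_separation sum_p C0 convC Ce.
exists (fun i => l \o single i : {scalar V}) => [i x|c Cc].
  apply: le_trans (lp _) _; rewrite (bigD1 i)//= big1 ?addr0 /single ?eqxx//.
  by move=> j /negPf ->; exact: sublinear0.
by have := lC c Cc; rewrite [in leRHS](sum_single c) linear_sum.
Qed.

End separation_of_families.

(** * Almost invariant probabilities *)

Section esum.
Variables (R : realType) (T : choiceType).
Implicit Types u v : T -> \bar R.

Lemma le_term_esum u t :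
  (forall t, 0 <= u t)%E -> (u t <= \esum_(t in [set: T]) u t)%E.
Proof.
by move=> u0; apply: esum_ge; exists [set t] => //; rewrite fsbig_set1.
Qed.

Lemma ge0_esumZl (a : R) u : 0 <= a -> (forall t, 0 <= u t)%E ->
  (\esum_(t in [set: T]) (a%:E * u t) = a%:E * \esum_(t in [set: T]) u t)%E.
Proof.
have esumZl_le (b : R) v : 0 <= b -> (forall t, 0 <= v t)%E ->
    (\esum_(t in [set: T]) (b%:E * v t) <= b%:E * \esum_(t in [set: T]) v t)%E.
  move=> b0 v0; apply: ge_ereal_sup => _ [X [finX _] <-].
  rewrite fsbig_finite// -ge0_sume_distrr// lee_wpmul2l ?lee_fin//.
  by apply: esum_ge; exists X => //; rewrite fsbig_finite.
rewrite le_eqVlt => /predU1P[<- u0|a0 u0].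
  by rewrite mul0e esum1// => t _; rewrite mul0e.
apply/eqP; rewrite eq_le esumZl_le ?(ltW a0)//= -lee_pdivlMl//.
apply: le_trans (esumZl_le a^-1 _ _ _); last first.
- by move=> t; rewrite mule_ge0// lee_fin ltW.
- by rewrite invr_ge0 ltW.
by apply: le_esum => t _; rewrite muleA -EFinM mulVf ?mul1e// gt_eqF.
Qed.

End esum.

Lemma esum_pair (R : realType) (S T : choiceType) (u : S -> T -> \bar R) :
  (forall s t, 0 <= u s t)%E ->
  (\esum_(s in [set: S]) \esum_(t in [set: T]) u s t =
   \esum_(st in [set: S * T]) u st.1 st.2)%E.
Proof.
move=> u0; rewrite esum_esum// (_ : _ `*`` _ = [set: S * T])//.
by apply/seteqP; split.
Qed.

Section dyadic_weights.
Variable R : realType.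

Definition dyad (n : nat) : R := 1 / (2 ^ n.+1)%:R.

Lemma dyad_gt0 n : 0 < dyad n.
Proof. by rewrite divr_gt0// ltr0n expn_gt0. Qed.

Lemma dyad_le1 n : dyad n <= 1.
Proof.
by rewrite ler_pdivrMr ?ltr0n ?expn_gt0// mul1r ler1n expn_gt0.
Qed.

Lemma esum_dyad_le1 (T : choiceType) (e : T -> nat) : injective e ->
  (\esum_(t in [set: T]) (dyad (e t))%:E <= 1)%E.
Proof.
move=> e_inj.
have dyad0 n : (0 <= (dyad n)%:E)%E by rewrite lee_fin ltW ?dyad_gt0.
apply: le_trans (epsilon_trick0 xpredT ler01); rewrite nneseries_esumT//.
rewrite -(esum_image setT e (fun n => (dyad n)%:E)) => [|s t _ _]; last first.
  exact: e_inj.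
by rewrite esum_mkcond; apply: le_esum => n _; case: ifP => // _; exact: dyad0.
Qed.

End dyadic_weights.

Lemma countable_injective (T : choiceType) :
  countable [set: T] -> exists e : T -> nat, injective e.
Proof.
by move=> /countable_injP[e e_inj]; exists e => s t; apply: e_inj; rewrite inE.
Qed.

Section ell1.
Variables (R : realType) (T : choiceType).
Implicit Types x y : T -> R.

Definition ell1_norm x : \bar R := \esum_(t in [set: T]) (`|x t|%:E).

Lemma ell1_norm_ge0 x : (0 <= ell1_norm x)%E.
Proof. by apply: esum_ge0 => t _; rewrite lee_fin. Qed.

Lemma ell1_normD x y : (ell1_norm (x + y)%R <= ell1_norm x + ell1_norm y)%E.
Proof.
rewrite /ell1_norm -esumD; [|by move=> *; rewrite lee_fin..].
by apply: le_esum => t _; rewrite -EFinD lee_fin ler_normD.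
Qed.

Lemma ell1_normZ a x : ell1_norm (a *: x)%R = (`|a|%:E * ell1_norm x)%E.
Proof.
rewrite /ell1_norm -ge0_esumZl//; apply: eq_esum => t _.
by rewrite -EFinM -normrM.
Qed.

Lemma ell1_normN x : ell1_norm (- x)%R = ell1_norm x.
Proof. by rewrite -scaleN1r ell1_normZ normrN1 mul1e. Qed.

Definition ell1_pred : {pred T -> R} := fun x => `[< (ell1_norm x < +oo)%E >].

Fact ell1_submod : submod_closed ell1_pred.
Proof.
split=> [|a x y /asboolP xf /asboolP yf].
  by apply/asboolP; rewrite /ell1_norm esum1 ?ltry// => t _; rewrite normr0.
apply/asboolP; apply: le_lt_trans (ell1_normD _ _) _.
by rewrite ell1_normZ lte_add_pinfty// lte_mul_pinfty// lee_fin.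
Qed.

HB.instance Definition _ :=
  GRing.isSubmodClosed.Build R (T -> R) ell1_pred ell1_submod.

Record ell1 := Ell1 { ell1_val :> T -> R; _ : ell1_val \in ell1_pred }.
HB.instance Definition _ := [isSub for ell1_val].
HB.instance Definition _ := [Choice of ell1 by <:].
HB.instance Definition _ := [SubChoice_isSubLmodule of ell1 by <:].

Definition ell1_fnorm (x : ell1) : R := fine (ell1_norm x).

Lemma ell1_fnormE (x : ell1) : ((ell1_fnorm x)%:E = ell1_norm x)%E.
Proof.
rewrite /ell1_fnorm fineK// ge0_fin_numE ?ell1_norm_ge0//.
by case: x => x /= xf; exact/asboolP.
Qed.

Lemma sublinear_ell1_fnorm : sublinear ell1_fnorm.
Proof.
split=> [x y|a x a0]; first by rewrite -lee_fin EFinD !ell1_fnormE ell1_normD.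
by apply: EFin_inj; rewrite EFinM !ell1_fnormE ell1_normZ ger0_norm.
Qed.

Definition prob_fun x :=
  (forall t, 0 <= x t) /\ \esum_(t in [set: T]) (x t)%:E = 1%E.

Lemma prob_fun_convex x y (a : R) : prob_fun x -> prob_fun y ->
  0 <= a <= 1 -> prob_fun (a *: x + (1 - a) *: y).
Proof.
move=> [x0 x1] [y0 y1] /andP[a0 a1]; have b0 : 0 <= 1 - a by rewrite subr_ge0.
split=> [t|] /=; first by rewrite addr_ge0// mulr_ge0.
under eq_esum do rewrite EFinD EFinM (EFinM (1 - a)).
rewrite esumD; [|by move=> t _; rewrite mule_ge0 ?lee_fin..].
rewrite !ge0_esumZl//; [|by move=> t; rewrite lee_fin..].
by rewrite x1 y1 !mule1 -EFinD addrC subrK.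
Qed.

Lemma prob_fun_delta (s : T) : prob_fun (fun t => (t == s)%:R).
Proof.
split=> [t|]; first by case: eqP.
rewrite (_ : (fun t => _) = fun t => if t \in [set s] then 1%E else 0%E).
  by rewrite -esum_mkcond esum_set1.
by apply/funext => t; rewrite in_set1; case: eqP.
Qed.

Lemma ell1_norm_prob x : prob_fun x -> ell1_norm x = 1%E.
Proof. by move=> [x0 <-]; apply: eq_esum => t _; rewrite ger0_norm. Qed.

Lemma prob_fun_ell1 x : prob_fun x -> x \in ell1_pred.
Proof. by move=> xP; apply/asboolP; rewrite ell1_norm_prob ?ltry. Qed.

Lemma exists_prob_fun_gt0 : countable [set: T] -> inhabited T ->
  exists2 x, prob_fun x & forall t, 0 < x t.
Proof.
move=> /countable_injective[e e_inj] [t0].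
have dyad0 t : (0 <= (dyad R (e t))%:E)%E by rewrite lee_fin ltW ?dyad_gt0.
set total := (\esum_(t in [set: T]) (dyad R (e t))%:E)%E.
have total_gt0 : (0 < total)%E.
  by apply: lt_le_trans (le_term_esum t0 dyad0); rewrite lte_fin dyad_gt0.
have total_fin : total \is a fin_num.
  rewrite ge0_fin_numE ?(ltW total_gt0)//.
  exact: le_lt_trans (esum_dyad_le1 R e_inj) (ltry _).
have ftotal_gt0 : 0 < fine total.
  by rewrite fine_gt0// total_gt0 -ge0_fin_numE ?(ltW total_gt0).
exists (fun t => (fine total)^-1 * dyad R (e t)) => [|t]; last first.
  by rewrite mulr_gt0 ?invr_gt0 ?dyad_gt0.
split=> [t|]; first by rewrite mulr_ge0 ?invr_ge0 ?ltW ?dyad_gt0.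
under eq_esum do rewrite EFinM.
rewrite ge0_esumZl ?invr_ge0 ?(ltW ftotal_gt0)// -/total.
by rewrite -[X in (_ * X)%E](fineK total_fin) -EFinM mulVf// gt_eqF.
Qed.

Definition delta (s : T) : ell1 := Ell1 (prob_fun_ell1 (prob_fun_delta s)).

Lemma ell1_fnorm_delta s : ell1_fnorm (delta s) = 1.
Proof. by rewrite /ell1_fnorm ell1_norm_prob//; exact: prob_fun_delta. Qed.

End ell1.

Section translation.
Variables (R : realType) (G : groupType).
Implicit Types (g : G) (x : G -> R) (p : G -> R).

Lemma set_bij_mulg g : set_bij [set: G] [set: G] (monoid.mul g).
Proof.
split=> //= [h k _ _|h _]; first exact: mulgI.
by exists (g^-1 * h)%g => //; rewrite mulVKg.
Qed.

Definition translate g x : G -> R := fun h => x (g^-1 * h)%g.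

Lemma ell1_norm_translate g x : ell1_norm (translate g x) = ell1_norm x.
Proof.
by rewrite /ell1_norm [RHS](reindex_esum _ _ _ _ (set_bij_mulg g^-1%g)).
Qed.

Fact translate_ell1 g (x : ell1 R G) : translate g x \in @ell1_pred R G.
Proof. by apply/asboolP; rewrite ell1_norm_translate -ell1_fnormE ltry. Qed.

Definition ell1_translate g (x : ell1 R G) : ell1 R G :=
  Ell1 (translate_ell1 g x).

Lemma ell1_translate_delta g k :
  ell1_translate g (delta R k) = delta R (g * k)%g.
Proof.
apply: val_inj; apply/funext => h /=; congr (nat_of_bool _)%:R.
by apply/eqP/eqP => [<-|->]; rewrite ?mulVKg ?mulKg.
Qed.

Lemma ell1_norm_translateB g p : prob_fun p ->
  (ell1_norm (translate g p - p)%R <= 2%:E)%E.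
Proof.
move=> p_prob; apply: le_trans (ell1_normD _ _) _.
by rewrite ell1_normN ell1_norm_translate ell1_norm_prob// -EFinD.
Qed.

Definition almost_invariant (S : set G) (e : R) p :=
  forall g, S g -> (ell1_norm (translate g p - p)%R <= e%:E)%E.

End translation.

Lemma bounded_funP (R : realType) (T : Type) (f : T -> R) :
  bounded_fun f <-> exists M, forall t, `|f t| <= M.
Proof.
split=> [/pinfty_ex_gt0[M _ fM]|[M fM]]; first by exists M => t; exact: fM.
exists M; split=> [|N MN t _ /=]; first exact: num_real.
exact: le_trans (fM t) (ltW MN).
Qed.

Section invariant_mean.
Variables (R : realType) (T : Type).
Implicit Types f g : T -> R.

Definition mean (m : (T -> R) -> R) :=
  (forall f a, bounded_fun f -> (forall t, a <= f t) -> a <= m f) /\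
  (forall f g, bounded_fun f -> bounded_fun g -> m (f + g) = m f + m g).

Variable m : (T -> R) -> R.
Hypothesis m_mean : mean m.

Lemma mean0 : m 0 = 0.
Proof.
have b0 : bounded_fun (0 : T -> R) by exact: bounded_cst.
have := m_mean.2 0 0 b0 b0.
by rewrite addr0; lra.
Qed.

Lemma meanB f g : bounded_fun f -> bounded_fun g -> m (f - g) = m f - m g.
Proof.
move=> bf bg; rewrite m_mean.2//; last exact: bounded_funN.
congr (_ + _); apply/eqP; rewrite -addr_eq0 -m_mean.2 ?addNr ?mean0//.
exact: bounded_funN.
Qed.

Lemma bounded_fun_sum (I : Type) (r : seq I) (F : I -> T -> R) :
  (forall i, bounded_fun (F i)) -> bounded_fun (\sum_(i <- r) F i).
Proof.
move=> bF; elim/big_ind: _ => [|f g bf bg|i _ //]; first exact: bounded_cst.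
exact: bounded_funD.
Qed.

Lemma mean_sum (I : Type) (r : seq I) (F : I -> T -> R) :
  (forall i, bounded_fun (F i)) ->
  m (\sum_(i <- r) F i) = \sum_(i <- r) m (F i).
Proof.
move=> bF; elim: r => [|i r ih]; first by rewrite !big_nil mean0.
by rewrite !big_cons m_mean.2 ?ih//; exact: bounded_fun_sum.
Qed.

End invariant_mean.

Lemma mean_average (R : realType) (T : Type) d (Y : measurableType d)
    (P : probability Y R) (m : Y -> (T -> R) -> R) :
  (forall y, mean (m y)) ->
  (forall f, bounded_fun f -> P.-integrable setT (EFin \o m ^~ f)) ->
  mean (fun f => \int[P]_(y in setT) m y f).
Proof.
move=> m_mean m_int; split=> [f a bf fa|f g bf bg].
  have <- : \int[P]_(y in setT) cst a y = a.
    by rewrite Rintegral_cst//= probability_setT mulr1.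
  apply: le_Rintegral => // [||y _]; last exact: (m_mean y).1.
    exact: finite_measure_integrable_cst.
  exact: m_int.
rewrite -RintegralD//; [|exact: m_int..].
by apply: eq_Rintegral => y _; exact: (m_mean y).2.
Qed.

Section reiter.
Variables (R : realType) (G : groupType).

(* Hahn-Banach separates the tuples of displacements [(s_i p - p)_i] from 0 by
   functionals [l_i] of norm at most 1, and [u i k := l_i (delta_k)]. *)
Lemma displacement_separation (I : finType) (s : I -> G) (e : R) :
  (forall p, prob_fun p -> ~ almost_invariant (range s) e p) ->
  exists2 u : I -> G -> R, (forall i, bounded_fun (u i)) &
    forall k, e <= \sum_i (u i (s i * k)%g - u i k).
Proof.
move=> far; pose d (x : ell1 R G) i := ell1_translate (s i) x - x.
pose C := [set d x | x in [set x : ell1 R G | prob_fun x]].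
have C_delta k : C (d (delta R k)).
  by exists (delta R k) => //; exact: prob_fun_delta.
have convC : convex_set C.
  move=> _ _ a /set_mem[x px <-] /set_mem[y py <-]; apply: mem_set.
  have a01 : 0 <= a%:num <= 1 by rewrite ge0 le1.
  exists (a%:num *: x + (1 - a%:num) *: y).
    exact: prob_fun_convex px py a01.
  apply/funext => i; rewrite /conv/= /d !fctE.
  rewrite !scalerBr addrACA -opprD; congr (_ - _).
  exact: val_inj.
have Ce c : C c -> e <= \sum_i ell1_fnorm (c i).
  move=> [x px <-]; have /existsNP[_ /not_implyP[[i _ <-] /negP]] := far _ px.
  rewrite -ltNge -[ell1_norm _](ell1_fnormE (d x i)) lte_fin => /ltW.
  move=> /le_trans; apply; rewrite (bigD1 i)//= lerDl sumr_ge0// => j _.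
  by rewrite fine_ge0// ell1_norm_ge0.
have [|l l_le lC] := hahn_banach_separation_family
  (sublinear_ell1_fnorm R G) _ convC Ce; first by exists (d (delta R 1%g)).
exists (fun i k => l i (delta R k)) => [i|k].
  apply/bounded_funP; exists 1 => k /=.
  rewrite ler_norml lerNl -linearN -(ell1_fnorm_delta R k) l_le andbT.
  by apply: le_trans (l_le _ _) _; rewrite /ell1_fnorm ell1_normN.
have := lC _ (C_delta k); congr (_ <= _); apply: eq_bigr => i _.
by rewrite /d linearB ell1_translate_delta.
Qed.

Lemma invariant_mean_reiter (m : (G -> R) -> R) (S : set G) (e : R) :
  mean m ->
  (forall g f, bounded_fun f -> m (fun k => f (g * k)%g) = m f) ->
  finite_set S -> 0 < e ->
  exists2 p : G -> R, prob_fun p & almost_invariant S e p.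
Proof.
move=> m_mean m_inv /finite_seqP[s ->] e0; apply: contrapT => no_p.
have [p pp ps|u u_bnd u_ge] := @displacement_separation (seq_sub s) val e.
  apply: no_p; exists p => // g gs.
  by apply: ps; exists (SeqSub gs).
have bnd_translate i g : bounded_fun (fun k => u i (g * k)%g).
  have /bounded_funP[M uM] := u_bnd i; apply/bounded_funP.
  by exists M.
have bnd_diff i : bounded_fun ((fun k => u i (val i * k)%g) - u i).
  by apply: bounded_funD => //; exact: bounded_funN.
have : e <= m (\sum_i ((fun k => u i (val i * k)%g) - u i)).
  apply: m_mean.1 => [|k]; first exact: bounded_fun_sum.
  by rewrite fct_sumE; exact: u_ge.
rewrite mean_sum// big1 ?leNgt ?e0// => i _.
by rewrite meanB// m_inv// subrr.
Qed.

End reiter.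

Section subtype_compact.
Variables (X : topologicalType) (A : set X).

Lemma compact_set_type : compact A -> compact [set: set_type A].
Proof.
move=> cA F FF _.
have FvA : (set_val @ F) A.
  rewrite /fmap/=; apply: filterS (@filterT _ F _) => x _ /=; exact: set_valP.
have [x [Ax clx]] := cA (set_val @ F) _ FvA.
exists (exist _ x (mem_set Ax)); split=> // B C FB.
move=> [_ [[W oW <-]] /= Wx WC].
have [z [Bz Wz]] := clx (set_val @` B) W
  (filterS (@preimage_image _ _ set_val B) FB) (open_nbhs_nbhs (conj oW Wx)).
case: Bz Wz => y By <- Wy; exists y; split=> //; exact: WC.
Qed.

Lemma hausdorff_set_type : hausdorff_space X -> hausdorff_space (set_type A).
Proof.
move=> hX x y clxy; apply: val_inj; apply: hX => B C Bx Cy.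
have [z [Bz Cz]] := clxy (set_val @^-1` B) (set_val @^-1` C)
  (initial_continuous Bx) (initial_continuous Cy).
by exists (set_val z).
Qed.

End subtype_compact.

Lemma continuous_prod_topology (I : Type) (K : I -> topologicalType)
    (W : topologicalType) (f : W -> prod_topology K) :
  (forall i, continuous (fun w => f w i)) -> continuous f.
Proof.
move=> fc w; apply/cvg_sup => i A [_ [[B oB <-]] /= Bfw BA].
have := fc i w B (open_nbhs_nbhs (conj oB Bfw)).
by apply: (@filterS _ (nbhs w)) => z /= Bz; exact: BA.
Qed.

Section borel.
Variables (R : realType) (X : ptopologicalType).
Local Notation borel T := (g_sigma_algebraType (@open T)).

Lemma continuous_borel (Y : ptopologicalType) (f : X -> Y) :
  continuous f -> measurable_fun setT (f : borel X -> borel Y).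
Proof.
move=> /continuousP cf.
apply: (@measurability _ _ (borel X) (borel Y) setT f (@open Y)) => //.
move=> _ [B oB <-]; rewrite setTI; apply: sub_sigma_algebra; exact: cf.
Qed.

Lemma continuous_borel_real (f : X -> R) :
  continuous f -> measurable_fun setT (f : borel X -> R).
Proof.
move=> /continuousP cf; apply: (measurability _ (RGenOpens.measurableE R)).
move=> _ [_ [a [b ->]] <-]; rewrite setTI; apply: sub_sigma_algebra.
by apply: cf; exact: interval_open.
Qed.

End borel.

Lemma integral_measure_preserving d (Y : measurableType d) (R : realType)
    (mu : {measure set Y -> \bar R}) (a : Y -> Y) (f : Y -> \bar R) :
  measurable_fun setT a ->
  (forall A, measurable A -> mu (a @^-1` A) = mu A) ->
  mu.-integrable setT (f \o a) -> measurable_fun setT f ->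
  (\int[mu]_x f (a x) = \int[mu]_x f x)%E.
Proof.
move=> ma mu_a fa_int mf.
have := @integral_pushforward _ _ Y Y R a ma mu setT _ mf fa_int measurableT.
rewrite preimage_setT => <-.
by apply: eq_measure_integral => A mA _; exact: mu_a.
Qed.

Section amenable_mean.
Variables (R : realType) (G : groupType).
Local Notation functionals := (prod_topology (fun _ : G -> R => R)).
Implicit Types (g : G) (f : G -> R) (x : functionals).

Lemma continuous_functional_eval f :
  continuous (fun x : functionals => x f).
Proof. exact: (@proj_continuous _ (fun=> R : topologicalType) f). Qed.

Lemma closed_mean : closed [set x : functionals | mean x].
Proof.
have -> : [set x : functionals | mean x] =
    (\bigcap_(c in [set c : (G -> R) * R |
         bounded_fun c.1 /\ forall t, c.2 <= c.1 t])
       [set x : functionals | c.2 <= x c.1]) `&`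
    (\bigcap_(c in [set c : (G -> R) * (G -> R) |
         bounded_fun c.1 /\ bounded_fun c.2])
       [set x : functionals | x (c.1 + c.2) - (x c.1 + x c.2) = 0]).
  apply/seteqP; split=> x [x_ge xD]; split.
  - by move=> [f a] [/= bf fa]; exact: x_ge.
  - by move=> [f g] [/= bf bg]; rewrite /= xD// subrr.
  - by move=> f a bf fa; exact: (x_ge (f, a)).
  - by move=> f g bf bg; apply/subr0_eq; exact: (xD (f, g)).
apply: closedI; apply: closed_bigI => -[f a] _ /=.
  apply: (@preimage_closed functionals R (fun x => x f) [set r | a <= r]).
    by move=> x _; exact: continuous_functional_eval.
  exact: closed_ge.
apply: (@preimage_closed functionals R (fun x => x (f + a) - (x f + x a))
  [set r | r = 0]).
  have eval := continuous_functional_eval.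
  move=> x _; exact: (cvgB (eval (f + a) x) (cvgD (eval f x) (eval a x))).
exact: closed_eq.
Qed.

(* [supnorm] is 0, the junk value of [sup], on unbounded functions. *)
Let supnorm f := sup (range (fun k => `|f k|)).

Let le_supnorm f k : bounded_fun f -> `|f k| <= supnorm f.
Proof.
move=> /bounded_funP[M fM]; apply: ub_le_sup; last by exists k.
by exists M => _ [l _ <-].
Qed.

Let means : set functionals :=
  [set x | forall f, `[- supnorm f, supnorm f]%classic (x f)] `&`
  [set x | mean x].

Let means_compact : compact means.
Proof.
apply: compact_closedI; last exact: closed_mean.
by apply: (@tychonoff _ (fun=> R : topologicalType)
  (fun f => `[- supnorm f, supnorm f]%classic)) => f; exact: segment_compact.
Qed.

Let eval_at1 : functionals := fun f => if `[< bounded_fun f >] then f 1%g else 0.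

Let means_eval_at1 : means eval_at1.
Proof.
split=> [f|]; last split=> [f a bf fa|f g bf bg].
- rewrite /= in_itv/= -ler_norml /eval_at1; case: asboolP => [|bf].
    exact: le_supnorm.
  rewrite /supnorm sup_out ?normr0// => -[_ [M fM]]; apply: bf.
  by apply/bounded_funP; exists M => k; apply: fM; exists k.
- by rewrite /eval_at1 asboolT.
- by rewrite /eval_at1 !asboolT//; exact: bounded_funD.
Qed.

Let shift g x : functionals :=
  fun f => x (fun k => f (g * k)%g).

Let supnorm_shift g f : supnorm (fun k => f (g * k)%g) = supnorm f.
Proof.
congr sup; apply/seteqP; split=> _ [k _ <-]; first by exists (g * k)%g.
by exists (g^-1 * k)%g => //; rewrite mulVKg.
Qed.

Let bounded_fun_shift g f : bounded_fun f -> bounded_fun (fun k => f (g * k)%g).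
Proof.
by move=> /bounded_funP[M fM]; apply/bounded_funP; exists M.
Qed.

Let means_shift g x : means x -> means (shift g x).
Proof.
move=> [x_le [x_ge xD]]; split=> [f|]; last split=> [f a bf fa|f h bf bh].
- by rewrite -(supnorm_shift g f); exact: x_le.
- by apply: x_ge => //; exact: bounded_fun_shift.
- by rewrite /shift -xD//; exact: bounded_fun_shift.
Qed.

Let continuous_shift g : continuous (shift g).
Proof.
by apply: continuous_prod_topology => f; exact: continuous_functional_eval.
Qed.

Theorem amenable_invariant_mean : amenable R G ->
  exists2 m : (G -> R) -> R, mean m &
    forall g f, bounded_fun f -> m (fun k => f (g * k)%g) = m f.
Proof.
pose base : set_type means := exist _ eval_at1 (mem_set means_eval_at1).
pose X : ptopologicalType :=
  HB.pack (set_type means) (isPointed.Build (set_type means) base).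
pose x_of (x : X) : functionals := set_val (x : set_type means).
have x_mean (x : X) : means (x_of x) by exact: set_valP.
pose alpha (g : G) (x : X) : X :=
  exist _ (shift g (x_of x)) (mem_set (means_shift g (x_mean x))).
have x_of_cont : continuous x_of by exact: initial_continuous.
have alpha_cont g : continuous (alpha g).
  apply: continuous_comp_initial => x.
  exact: (@continuous_comp X _ _ x_of (shift g) x (x_of_cont x)
    (@continuous_shift g (x_of x))).
move=> /(_ X alpha)[||//|x|g h x|P P_inv].
- exact: compact_set_type.
- by apply: hausdorff_set_type; apply: hausdorff_product => _; exact: Rhausdorff.
- by apply: val_inj; apply/funext => f /=; congr (x_of x _); apply/funext => k;
    rewrite mul1g.
- by apply: val_inj; apply/funext => f /=; congr (x_of x _); apply/funext => k;
    rewrite mulgA.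
have eval_cont f : continuous (fun x : X => x_of x f).
  move=> x; exact: (@continuous_comp X _ _ x_of (fun z => z f) x (x_of_cont x)
    (@continuous_functional_eval f (x_of x))).
have eval_int f : P.-integrable setT (EFin \o (fun x : X => x_of x f)).
  apply: measurable_bounded_integrable => //.
  - exact: le_lt_trans (probability_le1 P measurableT) (ltry 1).
  - exact: continuous_borel_real.
  apply: (bounded_funP (fun x : X => x_of x f)).2; exists (supnorm f) => x.
  by have := (x_mean x).1 f; rewrite /= in_itv/= -ler_norml.
exists (fun f => \int[P]_(x in setT) x_of x f) => [|g f _].
  apply: (@mean_average R G _ (g_sigma_algebraType (@open X)) P x_of) => // y.
  exact: (x_mean y).2.
rewrite /Rintegral; congr fine.
apply: (@integral_measure_preserving _ (g_sigma_algebraType (@open X)) R P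
  (alpha g) (fun y => (x_of y f)%:E)).
- exact: continuous_borel.
- exact: P_inv.
- exact: (eval_int (fun k => f (g * k)%g)).
- by apply/measurable_EFinP; exact: continuous_borel_real.
Qed.

End amenable_mean.

Theorem amenable_reiter (R : realType) (G : groupType) (S : set G) (e : R) :
  amenable R G -> countable [set: G] -> finite_set S -> 0 < e ->
  exists p : G -> R,
    [/\ prob_fun p, forall h, 0 < p h & almost_invariant S e p].
Proof.
move=> /amenable_invariant_mean[m m_mean m_inv] cG finS e0.
have e20 : 0 < e / 2 by rewrite divr_gt0.
have [q q_prob qS] := invariant_mean_reiter m_mean m_inv finS e20.
have [r r_prob r0] := exists_prob_fun_gt0 R cG (inhabits 1%g).
have e4 : 0 < 4 + e by rewrite addr_gt0.
pose b := 4 / (4 + e); have b0 : 0 <= b by rewrite divr_ge0// ltW.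
have b1 : 1 - b = e / (4 + e) by rewrite /b; field; rewrite gt_eqF.
have c0 : 0 < 1 - b by rewrite b1 divr_gt0.
exists (b *: q + (1 - b) *: r); split.
- by apply: prob_fun_convex => //; rewrite b0 -subr_ge0 ltW.
- by move=> h; apply: ltr_wpDl; [exact: mulr_ge0 b0 (q_prob.1 h)|exact: mulr_gt0].
move=> g gS.
have -> : translate g (b *: q + (1 - b) *: r) - (b *: q + (1 - b) *: r) =
    b *: (translate g q - q) + (1 - b) *: (translate g r - r).
  by rewrite !scalerBr addrACA -opprD.
apply: le_trans (ell1_normD _ _) _; rewrite !ell1_normZ !ger0_norm ?(ltW c0)//.
apply: (@le_trans _ _ (b%:E * (e / 2)%:E + (1 - b)%:E * 2%:E)%E).
  apply: leeD; rewrite lee_wpmul2l ?lee_fin ?(ltW c0)//; first exact: qS.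
  exact: ell1_norm_translateB.
rewrite -!EFinM -EFinD lee_fin b1 /b.
have -> : 4 / (4 + e) * (e / 2) + e / (4 + e) * 2 = e * (4 / (4 + e)).
  by field; rewrite gt_eqF.
by rewrite ler_piMr ?(ltW e0)// ler_pdivrMr// mul1r lerDl ltW.
Qed.

(** * The space L1[0,1] *)

Section L1_theory.
Variable R : realType.
Local Notation leb := (@lebesgue_measure R).
Local Notation I01 := (`[(0:R), (1:R)]%classic : set R).
Implicit Types f g h : R -> R.

Lemma measurable_I01 : measurable (I01 : set (measurableTypeR R)).
Proof. exact: measurable_itv. Qed.
Hint Resolve measurable_I01 : core.

Lemma L1_measurable f : L1 f -> measurable_fun I01 f.
Proof. by move=> /measurable_int /measurable_EFinP. Qed.

Lemma L1_of_integral f : measurable_fun I01 f ->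
  (\int[leb]_(x in I01) `|f x|%:E < +oo)%E -> L1 f.
Proof.
by move=> mf fi; apply/integrableP; split=> //; exact/measurable_EFinP.
Qed.

Lemma L1_0 : @L1 R 0.
Proof. exact: integrable0. Qed.

Lemma L1Z (a : R) f : L1 f -> L1 (a *: f).
Proof. by move=> Lf; have := integrableZl measurable_I01 a Lf. Qed.

Lemma L1D f g : L1 f -> L1 g -> L1 (f + g).
Proof. by move=> Lf Lg; have := integrableD measurable_I01 Lf Lg. Qed.

Lemma L1B f g : L1 f -> L1 g -> L1 (f - g).
Proof. by move=> Lf Lg; have := integrableB measurable_I01 Lf Lg. Qed.

Lemma L1_lin (a b : R) f g : L1 f -> L1 g -> L1 (a *: f + b *: g).
Proof. by move=> Lf Lg; apply: L1D; exact: L1Z. Qed.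

Lemma L1_normr f : L1 f -> L1 (fun x => `|f x|).
Proof. by move=> Lf; have := integrable_abse Lf. Qed.

Lemma norm1E f :
  L1 f -> ((norm1 f)%:E = \int[leb]_(x in I01) `|f x|%:E)%E.
Proof.
move=> Lf; rewrite /norm1 fineK//.
exact: integrable_fin_num (L1_normr Lf).
Qed.

Lemma norm1_ge0 f : 0 <= norm1 f.
Proof. by rewrite /norm1 fine_ge0// integral_ge0. Qed.

Lemma norm1D f g : L1 f -> L1 g -> norm1 (f + g) <= norm1 f + norm1 g.
Proof.
move=> Lf Lg; rewrite -lee_fin EFinD !norm1E//; last exact: L1D.
rewrite -ge0_integralD//; last 2 first.
- exact: measurable_int (L1_normr Lf).
- exact: measurable_int (L1_normr Lg).
apply: ge0_le_integral => //.
- exact: measurable_int (L1_normr (L1D Lf Lg)).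
- exact: measurable_int (L1D (L1_normr Lf) (L1_normr Lg)).
- by move=> x _; rewrite -EFinD lee_fin ler_normD.
Qed.

Lemma norm1Z (a : R) f : L1 f -> norm1 (a *: f) = `|a| * norm1 f.
Proof.
move=> Lf; apply: EFin_inj; rewrite EFinM !norm1E//; last exact: L1Z.
rewrite -ge0_integralZl//; last exact: measurable_int (L1_normr Lf).
by apply: eq_integral => x _; rewrite -EFinM -normrM.
Qed.

Lemma norm10 : norm1 (0 : R -> R) = 0.
Proof. by have := norm1Z 0 L1_0; rewrite scaler0 normr0 mul0r. Qed.

Lemma norm1N f : norm1 (- f) = norm1 f.
Proof. by congr fine; apply: eq_integral => x _; rewrite normrN. Qed.

Lemma norm1_distC f g : norm1 (f - g) = norm1 (g - f).
Proof. by rewrite -norm1N opprB. Qed.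

Lemma norm1_distD g f h : L1 f -> L1 g -> L1 h ->
  norm1 (f - h) <= norm1 (f - g) + norm1 (g - h).
Proof.
by move=> Lf Lg Lh; rewrite -[f - h](subrKA g) norm1D//; exact: L1B.
Qed.

Global Instance ae_lebesgue_filter : Filter (nbhs (almost_everywhere leb)) :=
  @ae_filter_ringOfSetsType _ (measurableTypeR R) R leb.

Lemma aeq_refl f : aeq f f.
Proof. exact: aeW. Qed.
Hint Resolve aeq_refl : core.

Lemma aeq_sym f g : aeq f g -> aeq g f.
Proof. by apply: filterS => x fg /fg. Qed.

Lemma aeq_trans g f h : aeq f g -> aeq g h -> aeq f h.
Proof. by apply: filterS2 => x fg gh Ix; rewrite fg// gh. Qed.

Lemma aeq_lin (a b : R) f g f' g' : aeq f f' -> aeq g g' ->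
  aeq (a *: f + b *: g) (a *: f' + b *: g').
Proof. by apply: filterS2 => x ff' gg' Ix; rewrite !fctE ff'// gg'. Qed.

Lemma aeqB f g f' g' : aeq f f' -> aeq g g' -> aeq (f - g) (f' - g').
Proof. by apply: filterS2 => x ff' gg' Ix; rewrite !fctE ff'// gg'. Qed.

Lemma aeq_norm1 f g : L1 f -> L1 g -> aeq f g -> norm1 f = norm1 g.
Proof.
move=> Lf Lg fg; congr fine; apply: ae_eq_integral => //.
- exact: measurable_int (L1_normr Lf).
- exact: measurable_int (L1_normr Lg).
- by apply: filterS fg => x fg Ix; rewrite fg.
Qed.

Lemma norm1_eq0 f : L1 f -> norm1 f = 0 <-> aeq f 0.
Proof.
move=> Lf; split=> [f0|f0]; last by rewrite (aeq_norm1 Lf L1_0 f0) norm10.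
have := norm1E Lf; rewrite f0 => /esym.
move=> /(ae_eq_integral_abs leb measurable_I01 (measurable_int leb Lf)).
by apply: filterS => x fx0 Ix; apply: EFin_inj; exact: fx0.
Qed.

Lemma aeq_subr0 f g : aeq f g <-> aeq (f - g) 0.
Proof.
split; apply: filterS => x fg Ix; first by rewrite !fctE fg// subrr.
by apply/subr0_eq; exact: fg.
Qed.

Lemma aeq_norm1B f g : L1 f -> L1 g -> aeq f g <-> norm1 (f - g) = 0.
Proof.
move=> Lf Lg; apply: iff_trans (aeq_subr0 f g) _.
by apply: iff_sym; apply: norm1_eq0; exact: L1B.
Qed.

Lemma ae_nonneg_normr f : ae_nonneg f <-> aeq (fun x => `|f x|) f.
Proof.
split; apply: filterS => x fx Ix; first by rewrite ger0_norm// fx.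
by rewrite -fx.
Qed.

End L1_theory.
#[local] Hint Resolve L1_0 aeq_refl : core.

Section LIso.
Variables (R : realType) (T : Op R).
Hypothesis T_LIso : is_LIso T.
Implicit Types f g : R -> R.

Lemma LIso_L1 f : L1 f -> L1 (T f).
Proof. by case: T_LIso => [[+ _ _ _ _] _]; exact. Qed.

Lemma LIso_aeq f g : L1 f -> L1 g -> aeq f g -> aeq (T f) (T g).
Proof. by case: T_LIso => [[_ + _ _ _] _]; exact. Qed.

Lemma LIso_lin (a b : R) f g : L1 f -> L1 g ->
  aeq (T (a *: f + b *: g)) (a *: T f + b *: T g).
Proof. by case: T_LIso => [[_ _ + _ _] _]; exact. Qed.

Lemma LIso_nonneg f : L1 f -> ae_nonneg f -> ae_nonneg (T f).
Proof. by case: T_LIso => [[_ _ _ + _] _]; exact. Qed.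

Lemma LIso_norm1 f : L1 f -> norm1 (T f) = norm1 f.
Proof. by case: T_LIso => [[_ _ _ _ +] _]; exact. Qed.

Lemma LIsoZ (a : R) f : L1 f -> aeq (T (a *: f)) (a *: T f).
Proof. by move=> Lf; have := LIso_lin a 0 Lf Lf; rewrite !scale0r !addr0. Qed.

Lemma LIsoB f g : L1 f -> L1 g -> aeq (T (f - g)) (T f - T g).
Proof.
by move=> Lf Lg; have := LIso_lin 1 (- 1) Lf Lg; rewrite !scaleN1r !scale1r.
Qed.

End LIso.

(** * Renorming by a family of functionals *)

Lemma subadditive_of_convex_sqr (R : realFieldType) (V : lmodType R)
    (A : set V) (N : V -> R) :
  (forall (a : R) x, A x -> A (a *: x)) ->
  (forall x, 0 <= N x) ->
  (forall (a : R) x, A x -> N (a *: x) = `|a| * N x) ->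
  (forall a b x y, 0 <= a -> 0 <= b -> a + b = 1 -> A x -> A y ->
    N (a *: x + b *: y) ^+ 2 <= a * N x ^+ 2 + b * N y ^+ 2) ->
  forall x y, A x -> A y -> N (x + y) <= N x + N y.
Proof.
move=> AZ N0 NZ N_convex x y Ax Ay; apply/ler_addgt0Pr => d d0.
pose s := N x + d / 2; pose t := N y + d / 2.
have s0 : 0 < s by rewrite ltr_wpDl// divr_gt0.
have t0 : 0 < t by rewrite ltr_wpDl// divr_gt0.
have st0 : 0 < s + t by rewrite addr_gt0.
have -> : N x + N y + d = s + t by rewrite /s /t; lra.
pose a := s / (s + t); pose b := t / (s + t).
have a0 : 0 < a by rewrite divr_gt0.
have b0 : 0 < b by rewrite divr_gt0.
have ab : a + b = 1 by rewrite -mulrDl divff ?gt_eqF.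
have := N_convex a b _ _ (ltW a0) (ltW b0) ab (AZ a^-1 x Ax) (AZ b^-1 y Ay).
rewrite !scalerA !divff ?gt_eqF// !scale1r !NZ//.
rewrite !ger0_norm ?invr_ge0 ?(ltW a0) ?(ltW b0)//.
move=> N_le; rewrite -ler_sqr ?nnegrE ?(ltW st0)//; apply: le_trans N_le _.
have le_sqr z r : 0 < r / (s + t) -> 0 <= z <= r ->
    r / (s + t) * ((r / (s + t))^-1 * z) ^+ 2 <= r * (s + t).
  move=> rst /andP[z0 zr].
  have r0 : 0 < r by move: rst; rewrite pmulr_lgt0// invr_gt0.
  have -> : r / (s + t) * ((r / (s + t))^-1 * z) ^+ 2 = (s + t) / r * z ^+ 2.
    by field; rewrite !gt_eqF.
  have -> : r * (s + t) = (s + t) / r * r ^+ 2 by field; rewrite gt_eqF.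
  by rewrite ler_wpM2l ?divr_ge0 ?(ltW st0) ?(ltW r0)// ler_sqr ?nnegrE ?(ltW r0).
apply: le_trans (lerD (le_sqr (N x) s a0 _) (le_sqr (N y) t b0 _)) _.
- by rewrite N0 lerDl divr_ge0 ?ltW.
- by rewrite N0 lerDl divr_ge0 ?ltW.
by rewrite -mulrDl.
Qed.

Section renorming.
Variables (R : realType) (T : choiceType) (ell : T -> (R -> R) -> R).
Implicit Types f g : R -> R.
Hypothesis ell_aeq : forall t f g, L1 f -> L1 g -> aeq f g -> ell t f = ell t g.
Hypothesis ell_lin : forall t (a b : R) f g, L1 f -> L1 g ->
  ell t (a *: f + b *: g) = a * ell t f + b * ell t g.
Hypothesis ell_le : forall f, L1 f ->
  (\esum_(t in [set: T]) (ell t f ^+ 2)%:E <= (norm1 f ^+ 2)%:E)%E.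
Hypothesis ell_eq0 : forall f, L1 f -> (forall t, ell t f = 0) -> aeq f 0.

Definition sqsum f : R := fine (\esum_(t in [set: T]) (ell t f ^+ 2)%:E)%E.

Definition renorm f : R := Num.sqrt (norm1 f ^+ 2 + sqsum f).

Let sqr_ell_ge0 f t : (0 <= (ell t f ^+ 2)%:E)%E.
Proof. by rewrite lee_fin sqr_ge0. Qed.

Let sqsumE f : L1 f ->
  ((sqsum f)%:E = \esum_(t in [set: T]) (ell t f ^+ 2)%:E)%E.
Proof.
move=> Lf; rewrite /sqsum fineK// ge0_fin_numE ?esum_ge0//.
exact: le_lt_trans (ell_le Lf) (ltry _).
Qed.

Let sqsum_ge0 f : 0 <= sqsum f.
Proof. by rewrite /sqsum fine_ge0// esum_ge0. Qed.

Let sqsum_le f : L1 f -> sqsum f <= norm1 f ^+ 2.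
Proof. by move=> Lf; rewrite -lee_fin sqsumE// ell_le. Qed.

Let sqsum_aeq f g : L1 f -> L1 g -> aeq f g -> sqsum f = sqsum g.
Proof.
by move=> Lf Lg fg; congr fine; apply: eq_esum => t _; rewrite (ell_aeq t Lf Lg).
Qed.

Let sqsumZ (a : R) f : L1 f -> sqsum (a *: f) = a ^+ 2 * sqsum f.
Proof.
move=> Lf; apply: EFin_inj; rewrite EFinM !sqsumE//; last exact: L1Z.
rewrite -ge0_esumZl ?sqr_ge0//; apply: eq_esum => t _; rewrite -EFinM -exprMn.
by have := ell_lin t a 0 Lf Lf; rewrite scale0r addr0 mul0r addr0 => ->.
Qed.

Let sqsum_convex (a b : R) f g : 0 <= a -> 0 <= b -> a + b = 1 ->
  L1 f -> L1 g ->
  sqsum (a *: f + b *: g) + a * b * sqsum (f - g) = a * sqsum f + b * sqsum g.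
Proof.
move=> a0 b0 ab Lf Lg; have ab0 := mulr_ge0 a0 b0.
have term_ge0 (c : R) h t : 0 <= c -> (0 <= c%:E * (ell t h ^+ 2)%:E)%E.
  by move=> c0; apply: mule_ge0 => //; rewrite lee_fin.
apply: EFin_inj; rewrite !EFinD !(EFinM _ (sqsum _)).
rewrite (sqsumE (L1_lin a b Lf Lg)) (sqsumE (L1B Lf Lg)) (sqsumE Lf) (sqsumE Lg).
rewrite -!ge0_esumZl// -!esumD//; do ?by move=> t _; exact: term_ge0.
apply: eq_esum => t _; rewrite -!EFinM -!EFinD ell_lin//.
have := ell_lin t 1 (- 1) Lf Lg; rewrite scale1r scaleN1r => ->.
by have -> : b = 1 - a by [lra]; congr EFin; ring.
Qed.

Let sqr_renorm f : renorm f ^+ 2 = norm1 f ^+ 2 + sqsum f.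
Proof. by rewrite /renorm sqr_sqrtr// addr_ge0// sqr_ge0. Qed.

Let renorm_ge0 f : 0 <= renorm f. Proof. exact: sqrtr_ge0. Qed.

Let renorm_convex (a b : R) f g : 0 <= a -> 0 <= b -> a + b = 1 ->
  L1 f -> L1 g ->
  renorm (a *: f + b *: g) ^+ 2 + a * b * sqsum (f - g) <=
  a * renorm f ^+ 2 + b * renorm g ^+ 2.
Proof.
move=> a0 b0 ab Lf Lg; rewrite !sqr_renorm -addrA sqsum_convex// !mulrDr addrACA.
rewrite lerD2r; apply: (@le_trans _ _ ((a * norm1 f + b * norm1 g) ^+ 2)).
  rewrite ler_sqr ?nnegrE ?addr_ge0 ?mulr_ge0 ?norm1_ge0//.
  apply: le_trans (norm1D (L1Z a Lf) (L1Z b Lg)) _.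
  by rewrite !norm1Z// !ger0_norm.
rewrite -subr_ge0; have bE : b = 1 - a by lra.
have -> : a * norm1 f ^+ 2 + b * norm1 g ^+ 2 - (a * norm1 f + b * norm1 g) ^+ 2 =
    a * b * (norm1 f - norm1 g) ^+ 2 by rewrite bE; ring.
by rewrite mulr_ge0 ?sqr_ge0// mulr_ge0.
Qed.

Let renormZ (a : R) f : L1 f -> renorm (a *: f) = `|a| * renorm f.
Proof.
move=> Lf; rewrite /renorm norm1Z// sqsumZ// exprMn real_normK ?num_real//.
by rewrite -mulrDr sqrtrM ?sqr_ge0// sqrtr_sqr.
Qed.

Lemma renorm_equiv_norm : equiv_norm renorm.
Proof.
split.
- move=> f g Lf Lg fg.
  by rewrite /renorm (aeq_norm1 Lf Lg fg) (sqsum_aeq Lf Lg fg).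
- move=> f g; apply: (subadditive_of_convex_sqr (A := @L1 R)) => //.
    by move=> a h; exact: L1Z.
  move=> a b h k a0 b0 ab Lh Lk; apply: le_trans (renorm_convex a0 b0 ab Lh Lk).
  by rewrite lerDl mulr_ge0// mulr_ge0.
- exact: renormZ.
exists 1, 2; split=> // f Lf; have := sqsum_le Lf; have := sqsum_ge0 f.
have := sqr_renorm f; have := renorm_ge0 f; have := norm1_ge0 f.
by split; nra.
Qed.

Lemma renorm_strictly_convex : strictly_convex renorm.
Proof.
move=> f g Lf Lg nfg fg.
have half0 : 0 <= 2^-1 :> R by rewrite invr_ge0.
have half1 : 2^-1 + 2^-1 = 1 :> R by lra.
have := renorm_convex half0 half0 half1 Lf Lg; rewrite -fg -mulrDl half1 mul1r.
rewrite -scalerDr (_ : 2^-1 *: (f + g) = fun x => (f x + g x) / 2); last first.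
  by apply/funext => x; rewrite !fctE mulrC.
move=> sqr_le; rewrite -ltr_sqr ?nnegrE//; apply: lt_le_trans sqr_le.
rewrite ltrDl mulr_gt0// ?mulr_gt0 ?invr_gt0// lt0r sqsum_ge0 andbT.
have Lfg := L1B Lf Lg.
apply/eqP => sq0; apply: nfg; apply/aeq_subr0; apply: ell_eq0 => // t.
have := le_term_esum t (sqr_ell_ge0 (f - g)); rewrite -sqsumE// sq0.
by rewrite lee_fin => le0; apply/eqP; rewrite -sqrf_eq0 eq_le le0 sqr_ge0.
Qed.

End renorming.

Lemma frequently_zero_lim (R : realType) (h : R -> R) (x l : R) :
  (forall a b, a < b -> exists2 y, a < y < b & h y = 0) ->
  h y @[y --> x^'] --> l -> l = 0.
Proof.
move=> h0 hl; apply: contrapT => /eqP l0.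
have [e /= e0 xe] := (nbhs_ballP _ _).1 (cvgr_neq0 _ hl l0).
have [y /andP[xy ye] hy] : exists2 y, x < y < x + e & h y = 0.
  by apply: h0; rewrite ltrDl.
have := xe y; rewrite /ball/= ltr0_norm ?subr_lt0// opprB hy eqxx ltrBlDl.
by move=> /(_ ye); rewrite gt_eqF// => /(_ isT).
Qed.

Section primitive.
Variable R : realType.
Local Notation leb := (@lebesgue_measure R).
Local Notation I01 := (`[(0:R), (1:R)]%classic : set R).
Implicit Types f g : R -> R.

Definition prim f (r : R) : R := \int[leb]_(x in `]-oo, r]) (f \_ I01) x.

Lemma prim_integrable f r :
  L1 f -> leb.-integrable `]-oo, r] (EFin \o (f \_ I01)).
Proof.
move=> Lf; have : leb.-integrable setT (EFin \o (f \_ I01)).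
  rewrite -restrict_EFin; apply/(integrable_restrict leb _ _ _).1 => //.
  by rewrite setTI.
by apply: integrableS => //; exact: measurable_itv.
Qed.

Lemma prim_lin (a b : R) f g r : L1 f -> L1 g ->
  prim (a *: f + b *: g) r = a * prim f r + b * prim g r.
Proof.
move=> Lf Lg; have If := prim_integrable r Lf; have Ig := prim_integrable r Lg.
have mI : measurable (`]-oo, r]%classic : set (measurableTypeR R)).
  exact: measurable_itv.
rewrite /prim -!RintegralZl// -RintegralD//; last 2 first.
- exact: (integrableZl mI a If).
- exact: (integrableZl mI b Ig).
apply: eq_Rintegral => x _; rewrite /patch; case: ifP => // _.
by rewrite !mulr0 addr0.
Qed.

Lemma prim_le_norm1 f r : L1 f -> `|prim f r| <= norm1 f.
Proof.
move=> Lf; have If := prim_integrable r Lf.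
have mI : measurable (`]-oo, r]%classic : set (measurableTypeR R)).
  exact: measurable_itv.
apply: le_trans (le_normr_Rintegral mI If) _.
rewrite -lee_fin norm1E// /Rintegral fineK; last first.
  exact: (integrable_fin_num mI (integrable_abse If)).
have -> : (\int[leb]_(x in `]-oo, r]) `|(f \_ I01) x|%:E =
    \int[leb]_(x in `]-oo, r]) ((fun x => `|f x|%:E) \_ I01) x)%E.
  by apply: eq_integral => x _; rewrite /patch; case: ifP => //; rewrite normr0.
rewrite -integral_mkcondr; apply: ge0_subset_integral => //.
- by apply: measurableI => //; exact: measurable_itv.
- exact: measurable_int (L1_normr Lf).
Qed.

Lemma prim_aeq f g r : L1 f -> L1 g -> aeq f g -> prim f r = prim g r.
Proof.
move=> Lf Lg /(aeq_norm1B Lf Lg) fg0; apply/eqP; rewrite -subr_eq0 -normr_le0.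
have -> : prim f r - prim g r = prim (f - g) r.
  by have := prim_lin 1 (- 1) r Lf Lg; rewrite scale1r scaleN1r mul1r mulN1r.
by rewrite -fg0; apply: prim_le_norm1; exact: L1B.
Qed.

Lemma prim_rat_eq0 f : L1 f -> (forall q : rat, prim f (ratr q) = 0) ->
  aeq f 0.
Proof.
move=> Lf prim0.
have freq0 a b : a < b -> exists2 y, a < y < b & prim f y = 0.
  by move=> /rat_in_itvoo[q]; rewrite in_itv/= => abq; exists (ratr q).
have := FTC1Ny (fun y => prim_integrable y Lf)
  (integrable_locally (@measurable_I01 R) Lf).
apply: filterS => x [dF Fx] Ix.
have <- : (f \_ I01) x = f x by rewrite patchE mem_set.
have Fx0 : prim f x = 0.
  apply: (frequently_zero_lim freq0).
  apply: cvg_trans (_ : prim f @ x --> prim f x).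
    by apply: cvg_app; exact: nbhs_dnbhs.
  exact/differentiable_continuous/derivable1_diffP.
rewrite -Fx derive1E; apply: (frequently_zero_lim _ dF) => a b ab /=.
have := freq0 (a + x) (b + x); rewrite ltrD2r => /(_ ab)[y /andP[ay yb] Fy].
exists (y - x); first by rewrite ltrBrDr ltrBlDr ay.
by rewrite [_ *: 1]mulr1 subrK -!/(prim _ _) Fx0 Fy subrr scaler0.
Qed.

Definition dyadic_prim (q : rat) f : R := dyad R (pickle q) * prim f (ratr q).

Lemma dyadic_prim_lin q (a b : R) f g : L1 f -> L1 g ->
  dyadic_prim q (a *: f + b *: g) = a * dyadic_prim q f + b * dyadic_prim q g.
Proof. by move=> Lf Lg; rewrite /dyadic_prim prim_lin//; ring. Qed.

Lemma dyadic_prim_aeq q f g :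
  L1 f -> L1 g -> aeq f g -> dyadic_prim q f = dyadic_prim q g.
Proof. by move=> Lf Lg fg; rewrite /dyadic_prim (prim_aeq _ Lf Lg fg). Qed.

Lemma dyadic_prim_eq0 f : L1 f -> (forall q, dyadic_prim q f = 0) -> aeq f 0.
Proof.
move=> Lf f0; apply: prim_rat_eq0 => // q.
by apply: (mulfI (lt0r_neq0 (dyad_gt0 R (pickle q)))); rewrite mulr0; exact: f0.
Qed.

Lemma esum_sqr_dyadic_prim_le f : L1 f ->
  (\esum_(q in [set: rat]) (dyadic_prim q f ^+ 2)%:E <= (norm1 f ^+ 2)%:E)%E.
Proof.
move=> Lf; have dyad0 q : 0 <= dyad R (pickle (q : rat)) by exact/ltW/dyad_gt0.
apply: (@le_trans _ _
  ((norm1 f ^+ 2)%:E * \esum_(q in [set: rat]) (dyad R (pickle q))%:E)%E).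
  rewrite -ge0_esumZl ?sqr_ge0//; apply: le_esum => q _.
  rewrite -EFinM lee_fin /dyadic_prim exprMn mulrC ler_pM ?sqr_ge0//.
    by rewrite -real_normK ?num_real// ler_sqr ?nnegrE ?norm1_ge0// prim_le_norm1.
  by rewrite expr2 ler_piMr// dyad_le1.
rewrite -[leRHS]mule1 lee_wpmul2l ?lee_fin ?sqr_ge0//.
by apply: esum_dyad_le1; exact: (pcan_inj pickleK).
Qed.

End primitive.

(** * Partitions of [0,1[ *)

Section countable.
Variables (R : realType) (T : choiceType).

Lemma nneseries_esum_inj (e : T -> nat) (u : nat -> \bar R) : injective e ->
  (forall k, 0 <= u k)%E -> (forall k, ~ range e k -> u k = 0)%E ->
  (\sum_(k <oo) u k = \esum_(t in [set: T]) u (e t))%E.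
Proof.
move=> e_inj u0 uz; rewrite -(esum_image setT e) => [|s t _ _]; last exact: e_inj.
rewrite nneseries_esumT// [RHS]esum_mkcond; apply: eq_esum => k _.
by case: ifPn => // /negP; rewrite inE => /uz.
Qed.

Lemma measurable_fun_countable_bigcup d d' (X : measurableType d)
    (Y : measurableType d') (A : T -> set X) (f : X -> Y) :
  countable [set: T] -> (forall t, measurable (A t)) ->
  (forall t, measurable_fun (A t) f) -> measurable_fun (\bigcup_t A t) f.
Proof.
move=> cT mA mf _ B mB; rewrite setI_bigcupl.
by apply: countable_bigcupT_measurable => // t; exact: mf.
Qed.

Definition glue (X Y : Type) (A : T -> set X) (F : T -> X -> Y) (y0 : Y) x : Y :=
  if pselect (exists t, A t x) is left ex then F (sval (cid ex)) x else y0.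

Lemma glueE (X Y : Type) (A : T -> set X) (F : T -> X -> Y) (y0 : Y) t x :
  trivIset setT A -> A t x -> glue A F y0 x = F t x.
Proof.
move=> tA Atx; rewrite /glue; case: pselect => [ex|[]]; last by exists t.
by congr F; case: cid => s /= Asx; apply: tA => //; exists x.
Qed.

Lemma measurable_glue d d' (X : measurableType d) (Y : measurableType d')
    (A : T -> set X) (F : T -> X -> Y) (y0 : Y) :
  countable [set: T] -> (forall t, measurable (A t)) -> trivIset setT A ->
  (forall t, measurable_fun setT (F t)) ->
  measurable_fun setT (glue A F y0).
Proof.
move=> cT mA tA mF; have mU := countable_bigcupT_measurable cT mA.
rewrite -(setUv (\bigcup_t A t)); apply/measurable_funU => //.
  exact: measurableC.
split.
  apply: measurable_fun_countable_bigcup => // t.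
  apply: (eq_measurable_fun (F t)) => [x|]; last exact: measurable_funTS.
  by rewrite inE => Atx; rewrite (glueE F y0 tA Atx).
apply: (eq_measurable_fun (cst y0)) => [x|]; last exact: measurable_cst.
rewrite inE => Ax; rewrite /glue; case: pselect => // -[t Atx].
by case: Ax; exists t.
Qed.

Lemma ge0_integral_countable_bigcup d (X : measurableType d)
    (mu : {measure set X -> \bar R}) (A : T -> set X) (f : X -> \bar R) :
  countable [set: T] -> (forall t, measurable (A t)) -> trivIset setT A ->
  measurable_fun setT f -> (forall x, 0 <= f x)%E ->
  (\int[mu]_(x in \bigcup_t A t) f x =
   \esum_(t in [set: T]) \int[mu]_(x in A t) f x)%E.
Proof.
move=> cT mA tA mf f0; have [e e_inj] := countable_injective cT.
pose B k := \bigcup_(t in e @^-1` [set k]) A t.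
have Be t : B (e t) = A t.
  rewrite /B (_ : e @^-1` _ = [set t]) ?bigcup_set1//.
  by apply/seteqP; split=> s /=; [exact: e_inj|move=> ->].
have B0 k : ~ range e k -> B k = set0.
  by move=> ek; apply: bigcup0 => t /= etk; case: ek; exists t.
have -> : \bigcup_t A t = \bigcup_k B k.
  apply/seteqP; split=> [x [t _ Atx]|x [k _ [t _ Atx]]]; last by exists t.
  by exists (e t) => //; exists t.
rewrite ge0_integral_bigcup//.
- rewrite (nneseries_esum_inj e_inj) => [|k|k /B0 ->].
  + by apply: eq_esum => t _; rewrite Be.
  + exact: integral_ge0.
  + exact: integral_set0.
- move=> k; have [[t _ <-]|/B0 ->] := pselect (range e k).
    by rewrite Be.
  exact: measurable0.
- exact: measurable_funTS.
- move=> k l _ _ [x [[s /= <- Asx] [t /= <- Atx]]]; congr e.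
  by apply: tA => //; exists x.
Qed.

End countable.

Section unit_partition.
Variables (R : realType) (T : choiceType).
Implicit Types (lo p : T -> R).

Definition piece lo p t : set R := `[lo t, lo t + p t[%classic.

Definition unit_partition lo p :=
  trivIset setT (piece lo p) /\ \bigcup_t piece lo p t = `[0, 1[%classic.

Lemma unit_partition_inj lo p s t x :
  unit_partition lo p -> piece lo p s x -> piece lo p t x -> s = t.
Proof. by move=> [tA _] sx tx; apply: tA => //; exists x. Qed.

Lemma unit_partition_sub lo p t :
  unit_partition lo p -> piece lo p t `<=` `[0, 1[%classic.
Proof. by move=> [_ <-]; exact: bigcup_sup. Qed.

Lemma pieceE lo p t x : 0 < p t ->
  piece lo p t x <-> exists2 r, 0 <= r < 1 & x = lo t + p t * r.
Proof.
move=> p0; rewrite /piece/= in_itv/=; split=> [/andP[lox xp]|[r /andP[r0 r1] ->]].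
  exists ((x - lo t) / p t); last by rewrite mulrC divfK ?gt_eqF// addrC subrK.
  by rewrite divr_ge0 ?subr_ge0 ?(ltW p0)//= ltr_pdivrMr// mul1r ltrBlDl.
by rewrite lerDl mulr_ge0 ?(ltW p0)//= ltrD2l -[ltRHS]mulr1 ltr_pM2l.
Qed.

Lemma unit_partition_coord lo p x :
  unit_partition lo p -> (forall t, 0 < p t) -> 0 <= x < 1 ->
  exists t, exists2 r, 0 <= r < 1 & x = lo t + p t * r.
Proof.
move=> [_ cover] p0 x01; have : `[0, 1[%classic x by rewrite /= in_itv.
by rewrite -cover => -[t _ /(pieceE _ _ (p0 t))[r r01 ->]]; exists t, r.
Qed.

Lemma unit_partition_ge0_lt1 lo p t r : unit_partition lo p -> 0 < p t ->
  0 <= r < 1 -> 0 <= lo t + p t * r < 1.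
Proof.
move=> lo_p p0 r01.
have : piece lo p t (lo t + p t * r) by apply/pieceE => //; exists r.
by move=> /(unit_partition_sub lo_p); rewrite /= in_itv.
Qed.

End unit_partition.

Lemma unit_partition_refine (R : realType) (S T : choiceType)
    (base width : S -> R) (lo p : T -> R) :
  unit_partition base width -> (forall s, 0 < width s) ->
  unit_partition lo p -> (forall t, 0 < p t) ->
  unit_partition (fun ts : T * S => base ts.2 + width ts.2 * lo ts.1)
    (fun ts => p ts.1 * width ts.2).
Proof.
move=> base_width width0 lo_p p0.
pose L (ts : T * S) := base ts.2 + width ts.2 * lo ts.1.
pose W (ts : T * S) := p ts.1 * width ts.2.
have pieceLW t s x : piece L W (t, s) x <->
    exists2 y, piece lo p t y & x = base s + width s * y.
  rewrite pieceE ?mulr_gt0//.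
  split=> [[r r01 ->]|[y /(pieceE _ _ (p0 t))[r r01 ->] ->]].
    exists (lo t + p t * r); first by apply/pieceE => //; exists r.
    by rewrite /L /W/=; ring.
  by exists r => //; rewrite /L /W/=; ring.
have piece_base t s y : piece lo p t y ->
    piece base width s (base s + width s * y).
  move=> /(unit_partition_sub lo_p); rewrite /= in_itv/= => y01.
  by apply/pieceE => //; exists y.
split.
  move=> [t s] [t' s'] _ _ [x [/pieceLW[y ty ->] /pieceLW[y' ty' E]]].
  have ss : s = s'.
    apply: (unit_partition_inj base_width (piece_base _ _ _ ty)).
    by rewrite E; exact: piece_base ty'.
  move: E; rewrite -ss => /addrI/(mulfI (lt0r_neq0 (width0 s))) yy.
  by move: ty'; rewrite -yy => ty'; rewrite (unit_partition_inj lo_p ty ty').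
apply/seteqP; split=> [x [[t s] _ /pieceLW[y ty ->]]|x].
  exact: unit_partition_sub base_width _ (piece_base t s y ty).
rewrite /= in_itv/= => /(unit_partition_coord base_width width0)[s [y y01 ->]].
have [t [r r01 yE]] := unit_partition_coord lo_p p0 y01.
exists (t, s) => //; apply/pieceLW; exists y => //.
by apply/pieceE => //; exists r.
Qed.

Section series_partition.
Variables (R : realType) (q : nat -> R).
Hypothesis q0 : forall k, 0 <= q k.
Hypothesis q1 : (\sum_(k <oo) (q k)%:E = 1)%E.

Let psum k := \sum_(i < k) q i.

Let psumS k : psum k.+1 = psum k + q k.
Proof. by rewrite /psum big_ord_recr. Qed.

Let le_psum k l : (k <= l)%N -> psum k <= psum l.
Proof.
move=> /subnK <-; elim: (l - k)%N => [|d ih]//.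
by rewrite addSn psumS (le_trans ih)// lerDl.
Qed.

Let psum_le1 k : psum k <= 1.
Proof.
rewrite -lee_fin -q1 /psum -sumEFin -(big_mkord xpredT (fun i => (q i)%:E)).
by apply: nneseries_lim_ge => i _ _; rewrite lee_fin.
Qed.

Let psum_gt x : x < 1 -> exists k, x < psum k.
Proof.
move=> x1; apply: contrapT => /forallNP no_k; move: x1; apply/negP.
rewrite -leNgt -lee_fin -q1; apply: lime_le.
  by apply: is_cvg_nneseries => i _ _; rewrite lee_fin.
apply: nearW => k; rewrite big_mkord sumEFin lee_fin leNgt.
by apply/negP; exact: no_k.
Qed.

Lemma unit_partition_series : unit_partition psum q.
Proof.
rewrite /unit_partition /piece; split.
  move=> k l _ _ [x [/=]]; rewrite !in_itv/= -!psumS => /andP[k1 k2] /andP[l1 l2].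
  case: (ltngtP k l) => // kl.
  - by have := lt_le_trans k2 (le_trans (le_psum kl) l1); rewrite ltxx.
  - by have := lt_le_trans l2 (le_trans (le_psum kl) k1); rewrite ltxx.
apply/seteqP; split=> [x [k _ /=]|x /=]; rewrite !in_itv/=.
  rewrite -psumS => /andP[kx xk]; rewrite (le_trans _ kx)/=; last exact: sumr_ge0.
  exact: lt_le_trans xk (psum_le1 _).
move=> /andP[x0 /psum_gt exk]; have [[|k] xk mink] := ex_minnP exk.
  by move: xk; rewrite /psum big_ord0 ltNge x0.
exists k => //=; rewrite in_itv/= -psumS xk andbT leNgt; apply/negP => /mink.
by rewrite ltnn.
Qed.

End series_partition.

Lemma exists_unit_partition (R : realType) (T : choiceType) (p : T -> R) :
  countable [set: T] -> prob_fun p -> exists lo, unit_partition lo p.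
Proof.
move=> /countable_injective[e e_inj] [p0 p1].
pose q k := fine (\esum_(t in e @^-1` [set k]) (p t)%:E).
have qe t : q (e t) = p t.
  rewrite /q (_ : e @^-1` _ = [set t]) ?esum_set1 ?lee_fin//.
  by apply/seteqP; split=> s /=; [exact: e_inj|move=> ->].
have q_out k : ~ range e k -> q k = 0.
  move=> ek; rewrite /q (_ : e @^-1` _ = set0) ?esum_set0//.
  by rewrite -subset0 => t /= etk; apply: ek; exists t.
have q0 k : 0 <= q k by rewrite fine_ge0// esum_ge0// => t _; rewrite lee_fin.
have q1 : (\sum_(k <oo) (q k)%:E = 1)%E.
  rewrite (nneseries_esum_inj e_inj) => [|k|k /q_out ->//].
    by under eq_esum do rewrite qe.
  by rewrite lee_fin.
have [disj cover] := unit_partition_series q0 q1.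
pose psum k := \sum_(i < k) q i; exists (psum \o e).
have pieceE t : piece (psum \o e) p t = piece psum q (e t) by rewrite /piece/= qe.
split=> [s t _ _|].
  by rewrite !pieceE => st; apply: e_inj; exact: disj.
rewrite -cover; apply/seteqP; split=> [x [t _]|x [k _ kx]].
  by rewrite pieceE => tx; exists (e t).
have [[t _ etk]|ek] := pselect (range e k).
  by exists t => //; rewrite pieceE etk.
by move: kx; rewrite /piece q_out// addr0 set_itvco0.
Qed.

Section change_of_variables.
Variable R : realType.
Local Notation leb := (@lebesgue_measure R).
Local Notation J := (`[(0:R), (1:R)[%classic : set R).
Local Notation RB := (measurableTypeR R).

Lemma measurable_J : measurable (J : set RB).
Proof. exact: measurable_itv. Qed.

Lemma measurable_affine (a c : R) :
  measurable_fun setT ((fun t => a + c * t) : RB -> RB).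
Proof.
apply: measurable_funD; first exact: measurable_cst.
by apply: measurable_funM; [exact: measurable_cst|exact: measurable_id].
Qed.

Lemma preimage_affine_itv (a c x y : R) (bx bY : bool) : 0 < c ->
  (fun t => a + c * t) @^-1` [set` Interval (BSide bx x) (BSide bY y)] =
  [set` Interval (BSide bx ((x - a) / c)) (BSide bY ((y - a) / c))].
Proof.
move=> c0; apply/seteqP; split=> t; case: bx bY => -[]; rewrite /= !in_itv/=
  ?(ler_pdivrMr, ler_pdivlMr, ltr_pdivrMr, ltr_pdivlMr)//
  ?(lerBlDl, lerBrDl, ltrBlDl, ltrBrDl) ?(mulrC c)//.
Qed.

Lemma pushforward_affine (a c : R) (c0 : 0 < c) (A : set RB) : measurable A ->
  pushforward (mscale (NngNum (ltW c0)) leb) (fun t : RB => a + c * t : RB) A =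
  leb A.
Proof.
move=> mA; apply/esym/lebesgue_measure_unique => //=.
  exact: measurable_affine.
move=> _ _ [[x y] _ <-] /=.
rewrite /pushforward/= /mscale/= preimage_affine_itv//.
rewrite !lebesgue_measure_itv/= !lte_fin ltr_pM2r ?invr_gt0// ltrD2r.
case: ifP => // _; last by rewrite mule0.
by rewrite -!EFinD -EFinM; congr EFin; field; rewrite gt_eqF.
Qed.

Lemma integral_affine (a c : R) (u : RB -> \bar R) : 0 < c ->
  measurable_fun setT u -> (forall x, 0 <= u x)%E ->
  (\int[leb]_(x in `[a, (a + c)%R[) u x =
   c%:E * \int[leb]_(t in J) u (a + c * t)%R)%E.
Proof.
move=> c0 mu u0; have mphi := measurable_affine a c.
have mI : measurable (`[a, a + c[%classic : set RB) by exact: measurable_itv.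
rewrite -[c]/(NngNum (ltW c0))%:num -ge0_integral_mscale//; last first.
  by apply: measurable_funTS; exact: measurableT_comp.
have -> : J = (fun t : RB => a + c * t : RB) @^-1` `[a, a + c[%classic.
  by rewrite preimage_affine_itv// subrr mul0r addrAC subrr add0r divff// gt_eqF.
rewrite -(ge0_integral_pushforward mphi)//; last exact: measurable_funTS.
by apply: eq_measure_integral => A mA _; exact/esym/pushforward_affine.
Qed.

Lemma integral_unit_partition (T : choiceType) (lo p : T -> R)
    (u : RB -> \bar R) :
  countable [set: T] -> unit_partition lo p -> (forall t, 0 < p t) ->
  measurable_fun setT u -> (forall x, 0 <= u x)%E ->
  (\int[leb]_(x in J) u x =
   \esum_(t in [set: T])
     ((p t)%:E * \int[leb]_(x in J) u (lo t + p t * x)%R))%E.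
Proof.
move=> cT [disj cover] p0 mu u0; rewrite -[in LHS]cover.
rewrite ge0_integral_countable_bigcup//; last first.
  by move=> t; exact: measurable_itv.
by apply: eq_esum => t _; exact: integral_affine.
Qed.

End change_of_variables.

(** * Spreading L1 over l1(T; L1) *)

(* A surjective lattice isometry of [L1] onto [l1(T; L1)], given by its
   coordinates. *)
Record ell1_lattice_isometry (R : realType) (T : choiceType)
    (D : T -> {linear (R -> R) -> (R -> R)}) : Prop := {
  coord_L1 : forall t f, L1 f -> L1 (D t f);
  coord_normr : forall t f, D t (fun x => `|f x|) = (fun x => `|D t f x|);
  coord_norm1 : forall f, L1 f ->
    (\esum_(t in [set: T]) (norm1 (D t f))%:E = (norm1 f)%:E)%E;
  coord_surj : forall F : T -> R -> R, (forall t, L1 (F t)) ->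
    (\esum_(t in [set: T]) (norm1 (F t))%:E < +oo)%E ->
    exists2 f, L1 f & forall t, aeq (D t f) (F t)
}.

Section half_open_interval.
Variable R : realType.
Local Notation leb := (@lebesgue_measure R).
Local Notation I01 := (`[(0:R), (1:R)]%classic : set R).
Local Notation J := (`[(0:R), (1:R)[%classic : set R).
Local Notation RB := (measurableTypeR R).
Implicit Types f g : R -> R.

Lemma sub_J_I01 : J `<=` I01.
Proof. by move=> x; rewrite /= !in_itv/= => /andP[-> /ltW]. Qed.

Lemma L1_measurable_J f : L1 f -> measurable_fun setT (f \_ J : RB -> R).
Proof.
move=> /L1_measurable mf; apply/(measurable_restrictT _ _).1.
  exact: measurable_J.
apply: measurable_funS mf; [exact: measurable_I01|exact: sub_J_I01].
Qed.

Lemma norm1J f : L1 f -> ((norm1 f)%:E = \int[leb]_(x in J) `|f x|%:E)%E.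
Proof.
move=> Lf; rewrite norm1E// [RHS]integral_itv_bndo_bndc//.
apply: (@measurable_funS _ _ RB _ I01); [exact: measurable_I01|exact: sub_J_I01|].
exact: measurable_int (L1_normr Lf).
Qed.

Lemma L1_of_J f : measurable_fun setT (f : RB -> R) ->
  (\int[leb]_(x in J) `|f x|%:E < +oo)%E -> L1 f.
Proof.
move=> mf fi; apply: L1_of_integral; first exact: measurable_funTS.
rewrite -integral_itv_bndo_bndc//; apply: measurable_funTS.
by apply/measurable_EFinP; exact: measurableT_comp.
Qed.

Lemma aeq_J f g : {in J, f =1 g} -> aeq f g.
Proof.
move=> fg; exists [set 1]; split.
- exact: measurable_set1.
- by rewrite lebesgue_measure_set1.
move=> x /= nfg; apply: contrapT => x1; apply: nfg => Ix; apply: fg.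
rewrite inE; move: Ix; rewrite /= !in_itv/= lt_neqAle => /andP[-> ->].
by rewrite andbT; apply/eqP.
Qed.

End half_open_interval.

Section spread.
Variables (R : realType) (S T : choiceType).
Variables (base width : S -> R) (lo p : T -> R).
Hypothesis countableS : countable [set: S].
Hypothesis countableT : countable [set: T].
Hypothesis base_width : unit_partition base width.
Hypothesis width0 : forall s, 0 < width s.
Hypothesis lo_p : unit_partition lo p.
Hypothesis p0 : forall t, 0 < p t.
Local Notation leb := (@lebesgue_measure R).
Local Notation J := (`[(0:R), (1:R)[%classic : set R).
Local Notation RB := (measurableTypeR R).
Implicit Types (f g : R -> R) (s : S) (t : T).

(* On each cell of the base partition, the affine map of that cell onto its
   [t]-th piece. *)
Definition stretch t : R -> R := glue (piece base width)
  (fun s x => base s + width s * lo t + p t * (x - base s)) 0.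

Lemma stretchE t s r : 0 <= r < 1 ->
  stretch t (base s + width s * r) = base s + width s * (lo t + p t * r).
Proof.
move=> r01; have sx : piece base width s (base s + width s * r).
  by apply/pieceE => //; exists r.
by rewrite /stretch (glueE _ _ base_width.1 sx); ring.
Qed.

Lemma measurable_stretch t : measurable_fun setT (stretch t : RB -> RB).
Proof.
apply: measurable_glue => //; first by move=> s; exact: measurable_itv.
  exact: base_width.1.
move=> s; apply: measurable_funD; first exact: measurable_cst.
apply: measurable_funM; first exact: measurable_cst.
by apply: measurable_funB; [exact: measurable_id|exact: measurable_cst].
Qed.

Lemma stretch_J t x : J x -> J (stretch t x).
Proof.
rewrite /= !in_itv/= => /(unit_partition_coord base_width width0)[s [r r01 ->]].
by rewrite stretchE//; do 2 apply: unit_partition_ge0_lt1 => //.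
Qed.

Lemma stretch_dist t x d :
  (forall s, width s <= d) -> J x -> `|stretch t x - x| < d.
Proof.
move=> width_le; rewrite /= in_itv/=.
move=> /(unit_partition_coord base_width width0)[s [r r01 ->]].
rewrite stretchE// opprD addrACA subrr add0r -mulrBr normrM gtr0_norm//.
apply: lt_le_trans (width_le s); rewrite gtr_pMr//.
have /andP[] := unit_partition_ge0_lt1 lo_p (p0 t) r01.
by move: r01 => /andP[]; rewrite ltr_norml; lra.
Qed.

Lemma integral_stretch (u : RB -> \bar R) :
  measurable_fun setT u -> (forall x, 0 <= u x)%E ->
  (\esum_(t in [set: T]) ((p t)%:E * \int[leb]_(x in J) u (stretch t x)) =
   \int[leb]_(x in J) u x)%E.
Proof.
move=> mu u0.
have refine := unit_partition_refine base_width width0 lo_p p0.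
rewrite (integral_unit_partition _ refine)//; last 2 first.
- by rewrite -setXTT; exact: countableX.
- by move=> ts; rewrite mulr_gt0.
rewrite -(@esum_pair _ _ _ (fun t s => (p t * width s)%:E *
  \int[leb]_(x in J) u (base s + width s * lo t + p t * width s * x)%R)%E).
  apply: eq_esum => t _.
  rewrite (integral_unit_partition countableS base_width width0)//; last first.
    exact: measurableT_comp mu (measurable_stretch t).
  rewrite -ge0_esumZl ?(ltW (p0 t))//; last first.
    by move=> s; rewrite mule_ge0 ?lee_fin ?(ltW (width0 s))// integral_ge0.
  apply: eq_esum => s _; rewrite muleA -EFinM; congr (_ * _)%E.
  apply: eq_integral => x; rewrite inE/= in_itv/= => x01.
  by rewrite stretchE//; congr u; ring.
move=> t s; rewrite mule_ge0 ?integral_ge0//.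
by rewrite lee_fin mulr_ge0 ?(ltW (p0 t)) ?(ltW (width0 s)).
Qed.

Definition spread t f : R -> R := fun x => p t * (f \_ J) (stretch t x).

Fact spread_linear t : linear (spread t).
Proof.
move=> a f g; apply/funext => x; rewrite /spread !fctE /patch.
by case: ifP => _; [rewrite /GRing.scale/=; ring|rewrite !mulr0 scaler0 addr0].
Qed.

HB.instance Definition _ t :=
  GRing.isLinear.Build R (R -> R) (R -> R) *:%R (spread t) (spread_linear t).

Lemma spread_restrict t f : spread t (f \_ J) = spread t f.
Proof. by rewrite /spread -patch_setI setIid. Qed.

Lemma spread_normr t f : spread t (fun x => `|f x|) = (fun x => `|spread t f x|).
Proof.
apply/funext => x; rewrite /spread normrM (gtr0_norm (p0 t)) /patch.
by case: ifP => // _; rewrite normr0.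
Qed.

Lemma measurable_spread t f : measurable_fun setT (f \_ J : RB -> R) ->
  measurable_fun setT (spread t f : RB -> R).
Proof.
move=> mf; apply: measurable_funM; first exact: measurable_cst.
exact: measurableT_comp mf (measurable_stretch t).
Qed.

Lemma integral_spread f : measurable_fun setT (f \_ J : RB -> R) ->
  (\esum_(t in [set: T]) \int[leb]_(x in J) `|spread t f x|%:E =
   \int[leb]_(x in J) `|f x|%:E)%E.
Proof.
move=> mf.
have mabs : measurable_fun setT ((fun x => `|(f \_ J) x|%:E) : RB -> \bar R).
  by apply/measurable_EFinP; exact: measurableT_comp.
transitivity (\int[leb]_(x in J) `|(f \_ J) x|%:E)%E; last first.
  by apply: eq_integral => x xJ; rewrite patchE xJ.
rewrite -integral_stretch//; apply: eq_esum => t _.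
rewrite -ge0_integralZl ?lee_fin ?(ltW (p0 t))//.
- by apply: eq_integral => x _; rewrite -EFinM /spread normrM (gtr0_norm (p0 t)).
- by apply: measurable_funTS; exact: measurableT_comp mabs (measurable_stretch t).
Qed.

Lemma L1_spread t f : L1 f -> L1 (spread t f).
Proof.
move=> Lf; have mf := L1_measurable_J Lf.
apply: L1_of_J; first exact: measurable_spread.
apply: le_lt_trans (ltry (norm1 f)); rewrite norm1J// -(integral_spread mf).
apply: (le_term_esum (u := fun t => \int[leb]_(x in J) `|spread t f x|%:E)%E).
by move=> s; exact: integral_ge0.
Qed.

Lemma esum_norm1_spread f : L1 f ->
  (\esum_(t in [set: T]) (norm1 (spread t f))%:E = (norm1 f)%:E)%E.
Proof.
move=> Lf; rewrite norm1J// -(integral_spread (L1_measurable_J Lf)).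
by apply: eq_esum => t _; rewrite norm1J//; exact: L1_spread.
Qed.

Lemma spread_interpolation (F : T -> R -> R) : (forall t, L1 (F t)) ->
  exists2 f, measurable_fun setT (f \_ J : RB -> R) &
    forall t, {in J, spread t f =1 F t}.
Proof.
move=> LF; pose L (ts : T * S) := base ts.2 + width ts.2 * lo ts.1.
pose W (ts : T * S) := p ts.1 * width ts.2.
have disj : trivIset setT (piece L W).
  exact: (unit_partition_refine base_width width0 lo_p p0).1.
pose f := glue (piece L W) (fun ts y => (F ts.1 \_ J)
  (base ts.2 + (y - L ts) / p ts.1) / p ts.1) 0.
exists f.
  apply/(measurable_restrictT _ _).1; first exact: measurable_J.
  apply: measurable_funTS; apply: measurable_glue => //.
  - by rewrite -setXTT; exact: countableX.
  - by move=> ts; exact: measurable_itv.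
  move=> ts; apply: measurable_funM; last exact: measurable_cst.
  apply: (measurableT_comp (L1_measurable_J (LF ts.1))).
  apply: measurable_funD; first exact: measurable_cst.
  apply: measurable_funM; last exact: measurable_cst.
  by apply: measurable_funB; [exact: measurable_id|exact: measurable_cst].
move=> t x xJ; have Jx : J x by rewrite inE in xJ.
rewrite /spread patchE mem_set; last exact: stretch_J.
move: (Jx); rewrite /= in_itv/=.
move=> /(unit_partition_coord base_width width0)[s [r r01 xE]].
have pc : piece L W (t, s) (stretch t x).
  apply/pieceE; first by rewrite mulr_gt0.
  by exists r => //; rewrite xE stretchE// /L /W/=; ring.
rewrite /f (glueE _ _ disj pc)/= mulrC divfK ?gt_eqF//.
rewrite {1}xE stretchE// /L/= (_ : base s + _ = x) ?patchE ?xJ// xE.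
by field; rewrite gt_eqF.
Qed.

Lemma spread_surj (F : T -> R -> R) : (forall t, L1 (F t)) ->
  (\esum_(t in [set: T]) (norm1 (F t))%:E < +oo)%E ->
  exists2 f, L1 f & forall t, aeq (spread t f) (F t).
Proof.
move=> LF Fy; have [f mf fF] := spread_interpolation LF.
exists (f \_ J) => [|t]; last by apply: aeq_J => x xJ; rewrite spread_restrict fF.
apply: L1_of_J => //; apply: le_lt_trans Fy.
rewrite -(@integral_spread (f \_ J)) -?patch_setI ?setIid//.
apply: le_esum => t _; rewrite norm1J// spread_restrict.
rewrite le_eqVlt; apply/orP; left; apply/eqP.
by apply: eq_integral => x xJ; rewrite fF.
Qed.

Theorem spread_lattice_isometry : ell1_lattice_isometry spread.
Proof.
split; [exact: L1_spread|exact: spread_normr|exact: esum_norm1_spread|].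
exact: spread_surj.
Qed.

End spread.

Lemma compact_uniform_continuity (R : realType) (X Y : pseudoMetricType R)
    (K : set X) (g : X -> Y) (e : R) :
  compact K -> continuous g -> 0 < e ->
  exists2 d, 0 < d & forall x y, K x -> ball x d y -> ball (g x) e (g y).
Proof.
move=> /compact_near_coveringP Kcover cg e0.
have [x Kx|d [near_d d0]] := @filter_ex _ (0 : R)^'+ _ _ (filterI
  (Kcover R 0^'+ (fun d x => forall y, ball x d y -> ball (g x) e (g y)) _ _)
  (nbhs_right_gt 0)).
  have e20 : 0 < e / 2 by rewrite divr_gt0.
  have /nbhs_ballP[r /= r0 ball_r] := cg x _ (nbhsx_ballx (g x) (e / 2) e20).
  have r20 : 0 < r / 2 by rewrite divr_gt0.
  exists (ball x (r / 2), [set d | d < r / 2]).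
    by split; [exact: nbhsx_ballx|exact: nbhs_right_lt].
  move=> [x' d] /= [xx' dr] y x'y.
  apply: (@ball_splitr _ _ (g x)); apply: ball_r.
    by apply: le_ball xx'; lra.
  rewrite (splitr r); apply: ball_triangle xx' _.
  exact: le_ball (ltW dr) _ x'y.
by exists d => // x y Kx; exact: near_d.
Qed.

Section tensor_approximation.
Variables (R : realType) (T : choiceType).
Local Notation leb := (@lebesgue_measure R).
Local Notation I01 := (`[(0:R), (1:R)]%classic : set R).
Local Notation J := (`[(0:R), (1:R)[%classic : set R).
Implicit Types (f g : R -> R) (p : T -> R).
Implicit Type D : T -> {linear (R -> R) -> (R -> R)}.

Definition tensor_dist D p f : \bar R :=
  \esum_(t in [set: T]) (norm1 (D t f - p t *: f))%:E.

Lemma tensor_dist_le D p f g : ell1_lattice_isometry D -> prob_fun p ->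
  L1 f -> L1 g ->
  (tensor_dist D p f <= tensor_dist D p g + (2 * norm1 (f - g)%R)%:E)%E.
Proof.
move=> isoD [p0 p1] Lf Lg; have Lfg := L1B Lf Lg.
have norm_ge0 h : (0 <= (norm1 h)%:E)%E by rewrite lee_fin norm1_ge0.
have -> : (2 * norm1 (f - g))%:E =
    (\esum_(t in [set: T]) (norm1 (D t (f - g)%R))%:E +
     \esum_(t in [set: T]) ((norm1 (f - g)%R)%:E * (p t)%:E))%E.
  rewrite (coord_norm1 isoD)// ge0_esumZl ?norm1_ge0// p1 mule1 -EFinD.
  by congr EFin; ring.
have pge0 t : (0 <= (norm1 (f - g)%R)%:E * (p t)%:E)%E.
  by rewrite mule_ge0// lee_fin.
rewrite /tensor_dist -!esumD//; last by move=> t _; rewrite adde_ge0.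
apply: le_esum => t _; rewrite -EFinM -!EFinD lee_fin.
have LDg := coord_L1 isoD t Lg; have LDfg := coord_L1 isoD t Lfg.
have -> : D t f - p t *: f = (D t g - p t *: g) + (D t (f - g) - p t *: (f - g)).
  rewrite linearB scalerBr -[LHS](subrK (D t g - p t *: g)) addrC.
  by congr (_ + _); rewrite opprD addrACA -opprD.
apply: le_trans (norm1D (L1B LDg (L1Z _ Lg)) (L1B LDfg (L1Z _ Lfg))) _.
rewrite lerD2l; apply: le_trans (norm1D LDfg _) _.
  by rewrite -scaleNr; exact: L1Z.
by rewrite norm1N norm1Z// ger0_norm// mulrC.
Qed.

Lemma norm1_le_sup_J f (c : R) : L1 f -> (forall x, J x -> `|f x| <= c) ->
  norm1 f <= c.
Proof.
move=> Lf f_le; rewrite -lee_fin norm1J//.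
apply: (@le_trans _ _ (\int[leb]_(x in J) (cst c%:E x))%E); last first.
  rewrite integral_cst; last exact: measurable_J.
  by rewrite /= lebesgue_measure_itv/= lte_fin ltr01 oppr0 adde0 mule1.
apply: ge0_le_integral => //.
apply: (measurable_funS _ (@sub_J_I01 R)); first exact: measurable_I01.
exact: measurable_int (L1_normr Lf).
Qed.

Lemma L1_dense_continuous f (e : R) : L1 f -> 0 < e ->
  exists g, [/\ continuous g, L1 g & norm1 (f - g) <= e].
Proof.
move=> Lf e0.
have I01y : (leb I01 < +oo)%E.
  by rewrite lebesgue_measure_itv/= lte_fin ltr01 oppr0 adde0 ltry.
have [g_ [cg Lg fg]] :=
  approximation_continuous_integrable (@measurable_I01 R) I01y Lf.
have [n _ g_near] : \forall n \near \oo,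
    (\int[leb]_(z in I01) `|(f z - g_ n z)%:E| < e%:E)%E.
  apply: (fg [set x | x < e%:E]%E); apply: open_nbhs_nbhs; split.
    exact: open_ereal_lt_ereal.
  by rewrite /= lte_fin.
exists (g_ n); split; [exact: cg|exact: Lg|].
rewrite -lee_fin norm1E; last exact: (L1B Lf (Lg n)).
exact: (ltW (g_near n (leqnn n))).
Qed.

Variables lo p : T -> R.
Hypothesis countableT : countable [set: T].
Hypothesis lo_p : unit_partition lo p.
Hypothesis p_prob : prob_fun p.
Hypothesis p0 : forall t, 0 < p t.

Let mesh n (i : 'I_n.+1) : R := n.+1%:R^-1.

Let mesh_gt0 n (i : 'I_n.+1) : 0 < mesh i.
Proof. by rewrite invr_gt0. Qed.

Let countable_ord n : countable [set: 'I_n.+1].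
Proof. exact: countableP. Qed.

Lemma tensor_dist_spread_continuous g (e : R) :
  continuous g -> L1 g -> 0 < e ->
  \forall n \near \oo, forall base : 'I_n.+1 -> R,
    unit_partition base (@mesh n) ->
    (tensor_dist (spread base (@mesh n) lo p) p g <= e%:E)%E.
Proof.
move=> cg Lg e0.
have [d d0 g_unif] := compact_uniform_continuity (@segment_compact R 0 1) cg e0.
near=> n; have mesh_lt : n.+1%:R^-1 < d.
  by near: n; exact: (near_infty_natSinv_lt (PosNum d0)).
move=> base base_mesh.
have isoD := spread_lattice_isometry (@countable_ord n) countableT base_mesh
  (@mesh_gt0 n) lo_p p0.
rewrite -[leRHS]mule1 -p_prob.2 -ge0_esumZl ?(ltW e0)//; last first.
  by move=> t; rewrite lee_fin p_prob.1.
apply: le_esum => t _; rewrite -EFinM lee_fin mulrC.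
apply: norm1_le_sup_J => [|x Jx].
  by apply: L1B; [exact: coord_L1 isoD _ _ Lg|exact: L1Z].
rewrite !fctE /= /spread patchE mem_set; last exact: stretch_J.
rewrite -[_ *: _]/(p t * g x) -mulrBr normrM gtr0_norm// ler_pM2l// distrC ltW//.
apply: g_unif; first exact: sub_J_I01.
by rewrite /ball/= distrC; apply: stretch_dist => // i; exact: ltW.
Unshelve. all: by end_near. Qed.

Lemma tensor_dist_spread f (e : R) : L1 f -> 0 < e ->
  \forall n \near \oo, forall base : 'I_n.+1 -> R,
    unit_partition base (@mesh n) ->
    (tensor_dist (spread base (@mesh n) lo p) p f <= e%:E)%E.
Proof.
move=> Lf e0; have e40 : 0 < e / 4 by rewrite divr_gt0.
have e20 : 0 < e / 2 by rewrite divr_gt0.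
have [g [cg Lg fg]] := L1_dense_continuous Lf e40.
apply: filterS (tensor_dist_spread_continuous cg Lg e20) => n g_le base base_mesh.
have isoD := spread_lattice_isometry (@countable_ord n) countableT base_mesh
  (@mesh_gt0 n) lo_p p0.
apply: le_trans (tensor_dist_le isoD p_prob Lf Lg) _.
apply: le_trans (leeD (g_le base base_mesh) (lexx _)) _.
by rewrite -EFinD lee_fin; lra.
Qed.

End tensor_approximation.

Lemma prob_fun_uniform (R : realType) (T : finType) :
  (0 < #|T|)%N -> prob_fun (fun _ : T => #|T|%:R^-1 : R).
Proof.
move=> T0; split=> [t|]; first by rewrite invr_ge0.
rewrite esum_fset; last 2 first.
- exact: finite_finset.
- by move=> t _; rewrite lee_fin invr_ge0.
rewrite (_ : [set: T] = [set` index_enum T]); last first.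
  by apply/seteqP; split=> t //= _; exact: mem_index_enum.
rewrite -fsbig_seq ?index_enum_uniq// sumEFin sumr_const -[_ *+ _]mulr_natl.
by rewrite divff// pnatr_eq0 -lt0n.
Qed.

Theorem exists_isometry_near_tensor (R : realType) (T : choiceType)
    (p : T -> R) (Psi : set (R -> R)) (e : R) :
  countable [set: T] -> prob_fun p -> (forall t, 0 < p t) ->
  finite_set Psi -> (forall f, Psi f -> L1 f) -> 0 < e ->
  exists2 D : T -> {linear (R -> R) -> (R -> R)}, ell1_lattice_isometry D &
    forall f, Psi f -> (tensor_dist D p f <= e%:E)%E.
Proof.
move=> cT p_prob p0 /finite_fsetP[s ->] sL1 e0.
have [lo lo_p] := exists_unit_partition cT p_prob.
have [n near_n] := @filter_ex _ \oo _ _ (filter_bigI _ (fun f fs =>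
  tensor_dist_spread cT lo_p p_prob p0 (sL1 f fs) e0)).
have := @prob_fun_uniform R 'I_n.+1; rewrite card_ord => /(_ isT) mesh_prob.
have [base base_mesh] := exists_unit_partition (countableP _) mesh_prob.
exists (spread base (fun=> n.+1%:R^-1) lo p).
  have mesh0 (i : 'I_n.+1) : 0 < n.+1%:R^-1 :> R by rewrite invr_gt0.
  exact: (spread_lattice_isometry (countableP _) cT base_mesh mesh0 lo_p p0).
by move=> f fs; exact: near_n.
Qed.

(** * The conjugated action *)

Section conjugate_action.
Variables (R : realType) (G : groupType) (rho : G -> Op R).
Variable D : G -> {linear (R -> R) -> (R -> R)}.
Hypothesis rho_action : is_action rho.
Hypothesis D_iso : ell1_lattice_isometry D.
Implicit Types (f : R -> R) (g h : G).

Let rho_LIso g : is_LIso (rho g).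
Proof. by case: rho_action. Qed.

Let rho1 f : L1 f -> aeq (rho 1%g f) f.
Proof. by case: rho_action => _ + _; exact. Qed.

Let rhoM g h f : L1 f -> aeq (rho (g * h)%g f) (rho g (rho h f)).
Proof. by case: rho_action => _ _; exact. Qed.

Let rho_L1 g f : L1 f -> L1 (rho g f).
Proof. exact: LIso_L1. Qed.

Let D_L1 h f : L1 f -> L1 (D h f).
Proof. exact: coord_L1. Qed.

Let D_eq0 f : L1 f -> (forall h, norm1 (D h f) = 0) -> aeq f 0.
Proof.
move=> Lf D0; apply/norm1_eq0 => //; apply: EFin_inj.
by rewrite -(coord_norm1 D_iso)// esum1// => h _; rewrite D0.
Qed.

Let D_aeq h f f' : L1 f -> L1 f' -> aeq f f' -> aeq (D h f) (D h f').
Proof.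
move=> Lf Lf' /(aeq_norm1B Lf Lf') ff'0.
apply/aeq_norm1B; [exact: D_L1|exact: D_L1|rewrite -linearB].
apply/eqP; rewrite eq_le norm1_ge0 andbT -lee_fin -ff'0.
rewrite -(coord_norm1 D_iso (L1B Lf Lf')).
apply: (le_term_esum (u := fun h => (norm1 (D h (f - f')%R))%:E)).
by move=> k; rewrite lee_fin norm1_ge0.
Qed.

Let D_inj f f' : L1 f -> L1 f' -> (forall h, aeq (D h f) (D h f')) -> aeq f f'.
Proof.
move=> Lf Lf' DD; apply/aeq_subr0; apply: D_eq0 => [|h]; first exact: L1B.
by rewrite linearB; apply/aeq_norm1B; [exact: D_L1|exact: D_L1|].
Qed.

(* The coordinates of the image under [g] of [(D h f)_h] for the action
   [(g F)(h) = rho_g (F (g^-1 h))] on [l1(G; L1)]. *)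
Definition conj_coord g f h := rho g (D (g^-1 * h)%g f).

Definition conj_action g f : R -> R :=
  xget 0 [set f' | L1 f' /\ forall h, aeq (D h f') (conj_coord g f h)].

Let conj_coord_L1 g f h : L1 f -> L1 (conj_coord g f h).
Proof. by move=> Lf; apply: rho_L1; exact: D_L1. Qed.

Let esum_conj_coord g f : L1 f ->
  (\esum_(h in [set: G]) (norm1 (conj_coord g f h))%:E = (norm1 f)%:E)%E.
Proof.
move=> Lf; rewrite -(coord_norm1 D_iso)//.
rewrite [RHS](reindex_esum _ _ _ _ (set_bij_mulg g^-1%g)).
by apply: eq_esum => h _; rewrite (LIso_norm1 (rho_LIso g))//; exact: D_L1.
Qed.

Let conj_spec g f : L1 f ->
  L1 (conj_action g f) /\
  forall h, aeq (D h (conj_action g f)) (conj_coord g f h).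
Proof.
move=> Lf; have [|f' Lf' f'E] := coord_surj D_iso (fun h => conj_coord_L1 g h Lf).
  by rewrite esum_conj_coord ?ltry.
exact: (@xgetPex _ 0 [set f' | L1 f' /\ forall h, aeq (D h f') (conj_coord g f h)]
  (ex_intro _ f' (conj Lf' f'E))).
Qed.

Let conj_L1 g f : L1 f -> L1 (conj_action g f).
Proof. by move=> /(conj_spec g)[]. Qed.

Let conjE g f h : L1 f -> aeq (D h (conj_action g f)) (conj_coord g f h).
Proof. by move=> /(conj_spec g)[_]; exact. Qed.

Let conj_uniq g f f' : L1 f -> L1 f' ->
  (forall h, aeq (D h f') (conj_coord g f h)) -> aeq (conj_action g f) f'.
Proof.
move=> Lf Lf' f'E; apply: D_inj => // [|h]; first exact: conj_L1.
by apply: aeq_trans (conjE g h Lf) _; apply: aeq_sym; exact: f'E.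
Qed.

Let conj_norm1 g f : L1 f -> norm1 (conj_action g f) = norm1 f.
Proof.
move=> Lf; apply: EFin_inj; rewrite -(coord_norm1 D_iso); last exact: conj_L1.
rewrite -(esum_conj_coord g Lf); apply: eq_esum => h _; congr EFin.
apply: aeq_norm1; [|exact: conj_coord_L1|exact: conjE].
by apply: D_L1; exact: conj_L1.
Qed.

Let conj1 f : L1 f -> aeq (conj_action 1%g f) f.
Proof.
move=> Lf; apply: conj_uniq => // h; apply: aeq_sym.
by rewrite /conj_coord invg1 mul1g; apply: rho1; exact: D_L1.
Qed.

Let conjM g g' f : L1 f ->
  aeq (conj_action (g * g')%g f) (conj_action g (conj_action g' f)).
Proof.
move=> Lf; have Lf' := conj_L1 g' Lf.
apply: conj_uniq => // [|h]; first exact: conj_L1.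
apply: aeq_trans (conjE g h Lf') _; rewrite /conj_coord.
apply: (aeq_trans (g := rho g (conj_coord g' f (g^-1 * h)%g))).
  by apply: LIso_aeq => //; [exact: D_L1|exact: conj_coord_L1|exact: conjE].
rewrite /conj_coord invgM -mulgA; apply: aeq_sym; apply: rhoM.
exact: D_L1.
Qed.

Let conj_aeq g f f' :
  L1 f -> L1 f' -> aeq f f' -> aeq (conj_action g f) (conj_action g f').
Proof.
move=> Lf Lf' ff'; apply: conj_uniq => // [|h]; first exact: conj_L1.
apply: aeq_trans (conjE g h Lf') _; apply: LIso_aeq => //; [exact: D_L1..|].
by apply: D_aeq => //; exact: aeq_sym.
Qed.

Let conj_lin g (a b : R) f f' : L1 f -> L1 f' ->
  aeq (conj_action g (a *: f + b *: f'))
    (a *: conj_action g f + b *: conj_action g f').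
Proof.
move=> Lf Lf'; apply: conj_uniq => [||h]; first exact: L1_lin.
  by apply: L1_lin; exact: conj_L1.
rewrite linearD !linearZ.
apply: aeq_trans (aeq_lin a b (conjE g h Lf) (conjE g h Lf')) _.
apply: aeq_sym; rewrite /conj_coord linearD !linearZ.
by apply: LIso_lin => //; exact: D_L1.
Qed.

Let conj_nonneg g f : L1 f -> ae_nonneg f -> ae_nonneg (conj_action g f).
Proof.
move=> Lf f0; have Lc := conj_L1 g Lf; apply/ae_nonneg_normr.
apply: D_inj => // [|h]; first exact: L1_normr.
rewrite (coord_normr D_iso); apply/ae_nonneg_normr.
have : ae_nonneg (conj_coord g f h).
  apply: LIso_nonneg => //; first exact: D_L1.
  apply/ae_nonneg_normr; rewrite -(coord_normr D_iso).
  by apply: D_aeq => //; [exact: L1_normr|exact/ae_nonneg_normr].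
by apply: filterS2 (conjE g h Lf) => x xE x0 Ix; rewrite xE// x0.
Qed.

Lemma conj_is_action : is_action conj_action.
Proof.
split; [|exact: conj1|exact: conjM] => g; split.
  split; [exact: conj_L1|exact: conj_aeq|exact: conj_lin|exact: conj_nonneg|].
  exact: conj_norm1.
move=> k Lk; exists (conj_action g^-1%g k); split; first exact: conj_L1.
apply: aeq_trans (conj1 Lk); apply: aeq_sym.
by rewrite -(mulgV g); exact: conjM.
Qed.

Lemma conj_action_dist (p : G -> R) g f : L1 f ->
  ((norm1 (conj_action g f - rho g f)%R)%:E <=
   tensor_dist D p f + (norm1 f)%:E * ell1_norm (translate g p - p)%R +
   tensor_dist D p (rho g f))%E.
Proof.
move=> Lf; have Lr := rho_L1 g Lf; have Lc := conj_L1 g Lf.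
rewrite -(coord_norm1 D_iso); last exact: L1B.
have -> : tensor_dist D p f = (\esum_(h in [set: G])
    (norm1 (D (g^-1 * h)%g f - p (g^-1 * h)%g *: f)%R)%:E)%E.
  by rewrite /tensor_dist [LHS](reindex_esum _ _ _ _ (set_bij_mulg g^-1%g)).
rewrite -ge0_esumZl; [|exact: norm1_ge0|by move=> h; rewrite lee_fin].
have norm_ge0 (k : R -> R) : (0 <= (norm1 k)%:E)%E
  by rewrite lee_fin norm1_ge0.
have term_ge0 h : (0 <= (norm1 f)%:E * `|(translate g p - p) h|%:E)%E.
  by rewrite mule_ge0// lee_fin.
rewrite -!esumD//; last by move=> h _; rewrite adde_ge0.
apply: le_esum => h _; rewrite -EFinM -!EFinD lee_fin linearB.
have Ld := D_L1 (g^-1 * h)%g Lf; set k := (g^-1 * h)%g in Ld *.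
have Lk := L1Z (p k) Lf; have Lkr := L1Z (p k) Lr; have Lhr := L1Z (p h) Lr.
apply: le_trans (norm1_distD (D_L1 h Lc) Lkr (D_L1 h Lr)) _.
rewrite -addrA; apply: lerD.
  rewrite -(LIso_norm1 (rho_LIso g) (L1B Ld Lk)) le_eqVlt; apply/orP; left.
  apply/eqP/aeq_norm1; [exact: L1B (D_L1 h Lc) Lkr|exact: rho_L1 (L1B Ld Lk)|].
  apply: aeq_trans (aeq_sym (LIsoB (rho_LIso g) Ld Lk)).
  by apply: aeqB; [exact: conjE|exact: aeq_sym (LIsoZ (rho_LIso g) _ Lf)].
apply: le_trans (norm1_distD Lkr Lhr (D_L1 h Lr)) _.
apply: lerD; last by rewrite norm1_distC.
rewrite -scalerBl norm1Z// (LIso_norm1 (rho_LIso g))// mulrC; exact: lexx.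
Qed.

Lemma conj_action_dist_le (p : G -> R) g f (M d e : R) :
  L1 f -> norm1 f <= M -> (ell1_norm (translate g p - p)%R <= d%:E)%E ->
  (tensor_dist D p f <= e%:E)%E -> (tensor_dist D p (rho g f) <= e%:E)%E ->
  norm1 (conj_action g f - rho g f) <= e + M * d + e.
Proof.
move=> Lf fM p_inv Df Drf; rewrite -lee_fin.
apply: le_trans (conj_action_dist p g Lf) _; rewrite !EFinD EFinM.
apply: leeD => //; apply: leeD => //.
by rewrite lee_pmul ?lee_fin ?norm1_ge0 ?ell1_norm_ge0.
Qed.

(* Coordinatewise, [conj_action] becomes left translation in the variables
   [F h = rho_(h^-1) (D h f)]. *)
Definition untwist h f := rho h^-1%g (D h f).

Let untwist_L1 h f : L1 f -> L1 (untwist h f).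
Proof. by move=> Lf; apply: rho_L1; exact: D_L1. Qed.

Let untwist_norm1 h f : L1 f -> norm1 (untwist h f) = norm1 (D h f).
Proof. by move=> Lf; rewrite (LIso_norm1 (rho_LIso _))//; exact: D_L1. Qed.

Let untwist_aeq h f f' :
  L1 f -> L1 f' -> aeq f f' -> aeq (untwist h f) (untwist h f').
Proof.
move=> Lf Lf' ff'; apply: (LIso_aeq (rho_LIso h^-1%g)); [exact: D_L1..|].
exact: D_aeq.
Qed.

Let untwist_lin h (a b : R) f f' : L1 f -> L1 f' ->
  aeq (untwist h (a *: f + b *: f')) (a *: untwist h f + b *: untwist h f').
Proof.
move=> Lf Lf'; rewrite /untwist linearD !linearZ.
by apply: LIso_lin => //; exact: D_L1.
Qed.

Let untwist_conj g h f : L1 f ->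
  aeq (untwist h (conj_action g f)) (untwist (g^-1 * h)%g f).
Proof.
move=> Lf; apply: (aeq_trans (g := rho h^-1%g (conj_coord g f h))).
  apply: (LIso_aeq (rho_LIso h^-1%g)); [|exact: conj_coord_L1|exact: conjE].
  by apply: D_L1; exact: conj_L1.
rewrite /untwist invgM invgK; apply: aeq_sym; apply: rhoM; exact: D_L1.
Qed.

Definition conj_functional (i : G * rat) f : R := dyadic_prim i.2 (untwist i.1 f).

Let conj_functional_aeq i f f' : L1 f -> L1 f' -> aeq f f' ->
  conj_functional i f = conj_functional i f'.
Proof.
move=> Lf Lf' ff'; apply: dyadic_prim_aeq; [exact: untwist_L1..|].
exact: untwist_aeq.
Qed.

Let conj_functional_lin i (a b : R) f f' : L1 f -> L1 f' ->
  conj_functional i (a *: f + b *: f') =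
  a * conj_functional i f + b * conj_functional i f'.
Proof.
move=> Lf Lf'; have [Lu Lu'] := (untwist_L1 i.1 Lf, untwist_L1 i.1 Lf').
rewrite /conj_functional -dyadic_prim_lin//; apply: dyadic_prim_aeq.
- by apply: untwist_L1; exact: L1_lin.
- exact: L1_lin.
- exact: untwist_lin.
Qed.

Let esum_conj_functional f :
  (\esum_(i in [set: G * rat]) (conj_functional i f ^+ 2)%:E =
   \esum_(h in [set: G]) \esum_(q in [set: rat])
     (dyadic_prim q (untwist h f) ^+ 2)%:E)%E.
Proof. by rewrite esum_pair// => h q; rewrite lee_fin sqr_ge0. Qed.

Let conj_functional_le f : L1 f ->
  (\esum_(i in [set: G * rat]) (conj_functional i f ^+ 2)%:E <=
   (norm1 f ^+ 2)%:E)%E.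
Proof.
move=> Lf.
have norm_ge0 h : (0 <= (norm1 (D h f))%:E)%E by rewrite lee_fin norm1_ge0.
rewrite esum_conj_functional expr2 EFinM -{2}(coord_norm1 D_iso Lf).
rewrite -ge0_esumZl ?norm1_ge0//; apply: le_esum => h _.
apply: le_trans (esum_sqr_dyadic_prim_le (untwist_L1 h Lf)) _.
rewrite untwist_norm1// -EFinM lee_fin expr2 ler_wpM2r ?norm1_ge0//.
by rewrite -lee_fin -(coord_norm1 D_iso Lf); exact: (le_term_esum h norm_ge0).
Qed.

Let conj_functional_eq0 f :
  L1 f -> (forall i, conj_functional i f = 0) -> aeq f 0.
Proof.
move=> Lf f0; apply: D_eq0 => // h; rewrite -untwist_norm1//.
apply/norm1_eq0; first exact: untwist_L1.
by apply: dyadic_prim_eq0 => [|q]; [exact: untwist_L1|exact: (f0 (h, q))].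
Qed.

Let sqsum_conj g f :
  L1 f -> sqsum conj_functional (conj_action g f) = sqsum conj_functional f.
Proof.
move=> Lf; rewrite /sqsum !esum_conj_functional; congr fine.
rewrite [RHS](reindex_esum _ _ _ _ (set_bij_mulg g^-1%g)).
apply: eq_esum => h _; apply: eq_esum => q _.
rewrite (dyadic_prim_aeq q _ _ (untwist_conj g h Lf))//; last exact: untwist_L1.
by apply: untwist_L1; exact: conj_L1.
Qed.

Lemma conj_action_admits_inv_sc_norm : admits_inv_sc_norm conj_action.
Proof.
exists (renorm conj_functional); split.
- exact: renorm_equiv_norm.
- by move=> g f Lf; rewrite /renorm (conj_norm1 g Lf) (sqsum_conj g Lf).
- exact: renorm_strictly_convex.
Qed.

End conjugate_action.

Lemma finite_set_norm1_bounded (R : realType) (Phi : set (R -> R)) :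
  finite_set Phi -> exists2 M, 0 < M & forall f, Phi f -> norm1 f <= M.
Proof.
move=> /finite_seqP[s ->]; exists (1 + \sum_(f <- s) norm1 f) => [|f fs].
  by rewrite ltr_pwDl// sumr_ge0// => f _; exact: norm1_ge0.
rewrite (big_rem f)//= addrCA lerDl addr_ge0// sumr_ge0// => f' _.
exact: norm1_ge0.
Qed.

Unset Implicit Arguments.

(* The quantification over [S], [Phi] and [eps] unfolds density for the product
   of the strong operator topologies via basic neighbourhoods. *)
Theorem theorem5p5 (R : realType) (G : groupType) :
  countable_group G -> amenable R G ->
  forall rho : G -> Op R, is_action rho ->
  forall (S : set G) (Phi : set (R -> R)),
    finite_set S -> finite_set Phi -> (forall f, Phi f -> L1 f) ->
  forall eps : R, 0 < eps ->
  exists rho' : G -> Op R,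
    [/\ is_action rho', admits_inv_sc_norm rho' &
        forall g f, S g -> Phi f ->
          norm1 (fun x => rho' g f x - rho g f x) < eps].
Proof.
move=> [e e_inj] amG rho rho_act S Phi finS finPhi PhiL1 eps eps0.
have cG : countable [set: G].
  by apply/countable_injP; exists e => g h _ _ /e_inj.
have [M M0 PhiM] := finite_set_norm1_bounded finPhi.
have d0 : 0 < eps / (4 * M) by rewrite divr_gt0// mulr_gt0.
have [p [p_prob p0 pS]] := amenable_reiter amG cG finS d0.
pose Psi := Phi `|` [set rho g f | g in S & f in Phi].
have finPsi : finite_set Psi.
  by rewrite finite_setU; split=> //; exact: finite_image2.
have PsiL1 f : Psi f -> L1 f.
  move=> [/PhiL1//|[g _ [f' /PhiL1 Lf' <-]]].
  by apply: LIso_L1 Lf'; case: rho_act.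
have e0 : 0 < eps / 4 by rewrite divr_gt0.
have [D D_iso D_near] := exists_isometry_near_tensor cG p_prob p0 finPsi PsiL1 e0.
exists (conj_action rho D); split.
- exact: conj_is_action.
- exact: conj_action_admits_inv_sc_norm.
move=> g f gS fPhi.
have Psi_rf : Psi (rho g f) by right; exists g => //; exists f.
have := conj_action_dist_le rho_act D_iso (PhiL1 f fPhi) (PhiM f fPhi) (pS g gS)
  (D_near f (or_introl fPhi)) (D_near _ Psi_rf).
have -> : M * (eps / (4 * M)) = eps / 4 by field; rewrite gt_eqF.
by move=> /le_lt_trans; apply; lra.
Qed.
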